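(* There exists a universal constant $C>0$ such that for any $0<\rho_n\le1$ and any integers $2\le k\le n$, $$\inf_{\widehat f}\ \sup_{W_0\in\mathcal W[k]}\mathbb E_{W_0}\left[\delta^2(\widehat f,f_0)\right]\ \ge\ C\left\{\left[\rho_n\left(\frac{k^2}{n^2}+\frac1n\right)+\rho_n^2\sqrt{\frac{k-1}{n}}\right]\wedge\rho_n^2\right\},$$ where $f_0=\rho_nW_0$, $\mathbb E_{W_0}$ denotes the expectation with respect to the distribution of the observations $\boldsymbol A'=(\boldsymbol A_{ij},1\le j<i\le n)$ when the underlying sparse graphon is $\rho_nW_0$, and $\inf_{\widehat f}$ is the infimum over all estimators.
   Context: A graphon is a symmetric measurable function $W:[0,1]^2\to[0,1]$. $\mathcal W[k]$ is the set of $k$-step graphons: graphons $W$ such that $W(x,y)=\boldsymbol Q_{\phi(x),\phi(y)}$ for all $x,y\in[0,1]$, for some symmetric real $k\times k$ matrix $\boldsymbol Q$ and some (measurable) $\phi:[0,1]\to\{1,\dots,k\}$. Sparse graphon model with graphon $W_0$ and scaling $\rho_n$: $\xi_1,\dots,\xi_n$ are unobserved i.i.d. uniform on $[0,1]$; conditionally on $(\xi_i)$, the observations $\boldsymbol A_{ij}$, $1\le j<i\le n$, are independent Bernoulli with parameters $\rho_nW_0(\xi_i,\xi_j)$. An estimator $\widehat f$ is any measurable function of $\boldsymbol A'$ taking values in the (bounded measurable) functions on $[0,1]^2$. Loss: $\delta^2(\check f,f_0)=\inf_\tau\iint_{(0,1)^2}|f_0(\tau(x),\tau(y))-\check f(x,y)|^2\,dx\,dy$,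 the infimum over all measure-preserving bijections $\tau:[0,1]\to[0,1]$. $a\wedge b=\min(a,b)$. *)

(* Defs.v *)
From HB Require Import structures.
From mathcomp Require Import all_boot all_order all_algebra.
From mathcomp Require Import all_classical all_reals all_analysis.

Set Implicit Arguments.
Unset Strict Implicit.
Unset Printing Implicit Defensive.
Import Order.TTheory GRing.Theory Num.Theory.
Import numFieldNormedType.Exports.
Local Open Scope classical_set_scope.
Local Open Scope ring_scope.

(* Functions on [0,1]^2 are represented by functions on R * R of which only
   the restriction to [0,1]^2 matters: every condition below is stated on
   [0,1]^2 and every integral is taken over a subset of a cube [0,1]^n.
   "Measurable" means Borel measurable. *)

Section graphons.
Context {R : realType}.
Implicit Types (W f : R * R -> R) (tau : R -> R).

Definition unit_itv : set R := `[0, 1].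

Definition graphon W : Prop :=
  [/\ measurable_fun (unit_itv `*` unit_itv) W,
      forall x y, unit_itv x -> unit_itv y -> W (x, y) = W (y, x)
    & forall x y, unit_itv x -> unit_itv y -> 0 <= W (x, y) <= 1].

(* Measurability of phi is that for the discrete sigma-algebra on 'I_k. *)
Definition step_graphon (k : nat) : set (R * R -> R) :=
  [set W | graphon W /\
    exists (Q : 'M[R]_k) (phi : R -> 'I_k),
      [/\ Q^T = Q,
          forall a : 'I_k, measurable (unit_itv `&` phi @^-1` [set a])
        & forall x y, unit_itv x -> unit_itv y ->
            W (x, y) = Q (phi x) (phi y)]].

Definition measure_preserving_bijection : set (R -> R) :=
  [set tau | [/\ set_bij unit_itv unit_itv tau,
                 measurable_fun unit_itv tau
               & forall A : set R, measurable A -> A `<=` unit_itv ->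
                   lebesgue_measure (unit_itv `&` tau @^-1` A)
                   = lebesgue_measure A]].

Definition delta2 (f f0 : R * R -> R) : \bar R :=
  ereal_inf [set (\int[lebesgue_measure \x lebesgue_measure]_(z in
                      `]0%R, 1%R[%classic `*` `]0%R, 1%R[%classic)
                    ((`|f0 (tau z.1, tau z.2) - f z| ^+ 2)%:E))%E
            | tau in measure_preserving_bijection].

End graphons.

Section product_power.
Context d (T : measurableType d) (R : realType).

Definition cons_pair n (x : T * n.-tuple T) : n.+1.-tuple T :=
  [the n.+1.-tuple T of x.1 :: x.2].

Lemma measurable_cons_pair n : measurable_fun setT (@cons_pair n).
Proof. exact: measurable_cons. Qed.

HB.instance Definition _ n :=
  isMeasurableFun.Build _ _ _ _ (@cons_pair n) (@measurable_cons_pair n).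

(* The law of n independent random variables of law P. *)
Fixpoint power_prob (P : probability T R) n : probability (n.-tuple T) R :=
  match n with
  | 0 => \d_ [tuple]
  | n.+1 => distribution (P \x power_prob P n)%E (@cons_pair n)
  end.

Lemma power_prob_rect (P : probability T R) n (A : 'I_n -> set T) :
  (forall i, measurable (A i)) ->
  power_prob P n [set x | forall i, A i (tnth x i)] = (\prod_(i < n) P (A i))%E.
Proof.
move=> mA; elim: n A mA => [|n IHn] A mA.
  by rewrite big_ord0 /= diracE mem_set//= => -[].
rewrite big_ord_recl /= /distribution /pushforward.
rewrite (_ : _ @^-1` _ = A ord0 `*`
    [set x : n.-tuple T | forall i, A (lift ord0 i) (tnth x i)]); last first.
  apply/seteqP; split=> [[t x] /= Ax|[t x] /= [At Ax] i].
    split=> [|i]; first by have := Ax ord0; rewrite tnth0.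
    by have := Ax (lift ord0 i); rewrite tnthS.
  by case: (unliftP ord0 i) => [j ->|->]; rewrite ?tnth0 ?tnthS.
rewrite product_measure1E//.
  by congr (_ * _)%E; apply: (IHn (fun i => A (lift ord0 i))).
have -> : [set x : n.-tuple T | forall i, A (lift ord0 i) (tnth x i)] =
    \bigcap_(i in [set: 'I_n]) ((@tnth n T)^~ i @^-1` A (lift ord0 i)).
  by apply/seteqP; split=> x /= Ax i => [_|]; exact: Ax.
apply: fin_bigcap_measurable => // i _.
by rewrite -[X in measurable X]setTI; exact: measurable_tnth.
Qed.

End product_power.

Section sparse_graphon_model.
Context {R : realType}.
Implicit Types (W : R * R -> R) (rho : R).

(* The index set of the observations: pairs (i, j) with j < i. *)
Definition edge n := {e : 'I_n * 'I_n | (e.2 < e.1)%N}.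

Definition observation n := {ffun edge n -> bool}.

Definition unit_cube n : set (n.-tuple (measurableTypeR R)) :=
  [set xi | forall i, unit_itv (tnth xi i)].
Arguments unit_cube : clear implicits.

Definition uniform_cube n : probability (n.-tuple (measurableTypeR R)) R :=
  power_prob (uniform_prob (@ltr01 R)) n.

(* Conditionally on xi, the A_ij are independent Bernoulli with parameters
   rho * W (xi_i, xi_j). *)
Definition cond_pmf n rho W (xi : n.-tuple (measurableTypeR R))
    (a : observation n) : R :=
  \prod_(e : edge n)
    bernoulli_pmf (rho * W (tnth xi (val e).1, tnth xi (val e).2)) (a e).

Definition obs_pmf n rho W (a : observation n) : \bar R :=
  (\int[uniform_cube n]_(xi in unit_cube n) (cond_pmf rho W xi a)%:E)%E.

Definition expect n rho W (X : observation n -> \bar R) : \bar R :=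
  (\sum_(a : observation n) obs_pmf rho W a * X a)%E.

(* [observation n] is finite, so measurability in the data is automatic. *)
Definition estimator n : set (observation n -> R * R -> R) :=
  [set f : observation n -> R * R -> R |
    forall a, measurable_fun (unit_itv `*` unit_itv) (f a) /\
      exists M : R, forall x y, unit_itv x -> unit_itv y -> `|f a (x, y)| <= M].
Arguments estimator : clear implicits.

Definition risk n rho W (f : observation n -> R * R -> R) : \bar R :=
  expect rho W (fun a => delta2 (f a) (fun z => rho * W z)).

Definition minimax_risk n k rho : \bar R :=
  ereal_inf [set ereal_sup [set risk rho W f | W in step_graphon k]
            | f in estimator n].

End sparse_graphon_model.
Arguments unit_cube {R} n _.
Arguments estimator {R} n _.

(* Main.v *)
(* The three rates are proved separately, each by testing against a finite
   family of step graphons.  For a family whose laws are all dominated, up to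
   constants, by one reference law, it suffices to bound the number of members
   that a single function can approximate for the distance modulo
   measure-preserving bijections.  If f approximates two step graphons, the
   bijections involved induce a coupling of the two block distributions whose
   quadratic loss is small.  Rounding the coupling, row by row and
   independently, gives a map pi of the blocks with small expected loss, and
   only k^k maps have to be considered.

   - rho / n: the constant graphon 1/2 against 1/2 +- eps/2 on two equal blocks;
     the second moment of the likelihood ratio is a moment generating function
     of a squared Rademacher sum.
   - rho k^2 / n^2, for large k: 1/2 +- eps/2 with arbitrary signs on k equal
     blocks, against the constant 1/2.  The k^k Hamming balls (one for each map)
     contain only a tiny fraction of the 2^(k(k-1)/2) sign patterns.
   - rho^2 sqrt(k / n), for large k: block sizes (1 +- s) / (2K) around the
     balanced ones, with a fixed 0/1 matrix which every map pi changes in at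
     least a constant times k entries per moved block.  Such a matrix exists by
     counting, and it forces the loss to dominate the total variation distance
     of the block sizes.  For small k, two blocks of unequal sizes suffice. *)

Require Import Defs.
From mathcomp Require Import all_boot all_order all_algebra.
From mathcomp Require Import all_classical all_reals all_analysis measurable_realfun.
From mathcomp Require Import ring lra.
Set Implicit Arguments.
Unset Strict Implicit.
Unset Printing Implicit Defensive.
Import Order.TTheory GRing.Theory Num.Theory.
Import numFieldNormedType.Exports.
Local Open Scope classical_set_scope.
Local Open Scope ring_scope.

(** * Step graphons and their observations *)

Lemma integral_finite_sum d (X : measurableType d) (R : realType)
    (mu : {measure set X -> \bar R}) (D : set X) (L : finType)
    (A : L -> set X) (F : L -> R) :
  measurable D -> (forall l, measurable (A l)) -> (forall l, 0 <= F l) ->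
  (\int[mu]_(x in D) (\sum_l F l * \1_(A l) x)%:E =
   \sum_l (F l)%:E * mu (A l `&` D))%E.
Proof.
move=> mD mA F0.
have m1 l : measurable_fun D (EFin \o (\1_(A l) : X -> R)).
  by apply/measurable_EFinP; exact: measurable_indic.
under eq_integral do rewrite -sumEFin.
rewrite ge0_integral_sum //.
- apply: eq_bigr => l _; under eq_integral do rewrite EFinM.
  have /= -> := @ge0_integralZl _ _ _ mu _ mD _ (m1 l) (F l)%:E.
  - by rewrite integral_indic.
  - by move=> x _; rewrite lee_fin.
  - by rewrite lee_fin.
- by move=> l; apply/measurable_EFinP; apply: measurable_funM => //;
    exact/measurable_EFinP.
- by move=> l x _; rewrite lee_fin mulr_ge0.
Qed.

(** Presents a function that is constant on the cells of a finite partition as a combination of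
    indicators, ready for [integral_finite_sum]. *)
Lemma sum_indic_unique (R : realType) (X : Type) (L : finType) (A : L -> set X)
    (F : L -> R) (l0 : L) (x : X) :
  (forall l, A l x <-> l = l0) -> \sum_l F l * \1_(A l) x = F l0.
Proof.
move=> Al; rewrite (bigD1 l0) //= big1 ?addr0 => [|l ll0].
  by rewrite indicE mem_set ?mulr1 //; apply/Al.
rewrite indicE memNset ?mulr0 // => /Al ll0'.
by rewrite ll0' eqxx in ll0.
Qed.

Definition labeling (R : realType) (T : finType) (p : T -> R) (phi : R -> T) :=
  forall t, measurable (unit_itv `&` phi @^-1` [set t]) /\
    lebesgue_measure (unit_itv `&` phi @^-1` [set t] : set R) = (p t)%:E.

Definition label_pmf (R : realType) (T : finType) n (p : T -> R)
    (l : {ffun 'I_n -> T}) : R := \prod_i p (l i).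

Definition sbm_cond (R : realType) (T : finType) n (Q : T -> T -> R)
    (l : {ffun 'I_n -> T}) (a : observation n) : R :=
  \prod_(e : edge n) bernoulli_pmf (Q (l (val e).1) (l (val e).2)) (a e).

(** The stochastic block model: vertices get independent labels of law [p], then pairs are joined
    independently with probabilities given by [Q]. *)
Definition sbm_pmf (R : realType) (T : finType) n (p : T -> R)
    (Q : T -> T -> R) (a : observation n) : R :=
  \sum_l label_pmf p l * sbm_cond Q l a.

Lemma uniform_prob_sub (R : realType) (A : set R) :
  measurable A -> A `<=` unit_itv ->
  uniform_prob (@ltr01 R) A = lebesgue_measure A.
Proof.
move=> mA AI; rewrite /uniform_prob integral_uniform_pdf setIidl //.
rewrite (eq_integral (fun=> 1%E)) => [|x].
  by rewrite integral_cst // mul1e.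
rewrite inE => /AI; rewrite /unit_itv/= in_itv/= => xI.
by rewrite /uniform_pdf xI subr0 invr1.
Qed.

(** The conditional likelihood depends on the latent points only through their labels, so the
    integral over the cube splits into boxes, one for each label vector, whose measures are
    products. *)
Lemma obs_pmf_sbm (R : realType) (T : finType) n (p : T -> R) (phi : R -> T)
    (Q : T -> T -> R) (W : R * R -> R) rho (a : observation n) :
  labeling p phi -> (forall s t, 0 <= rho * Q s t <= 1) ->
  (forall x y, unit_itv x -> unit_itv y -> W (x, y) = Q (phi x) (phi y)) ->
  obs_pmf rho W a = (sbm_pmf p (fun s t => rho * Q s t) a)%:E.
Proof.
move=> lphi Q01 WQ; rewrite /obs_pmf.
pose S t : set (measurableTypeR R) := unit_itv `&` phi @^-1` [set t].
pose A (l : {ffun 'I_n -> T}) : set (n.-tuple (measurableTypeR R)) :=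
  [set xi | forall i, S (l i) (tnth xi i)].
have mrect (B : 'I_n -> set (measurableTypeR R)) :
    (forall i, measurable (B i)) ->
    measurable [set xi : n.-tuple (measurableTypeR R) | forall i, B i (tnth xi i)].
  move=> mB.
  have -> : [set x : n.-tuple _ | forall i, B i (tnth x i)] =
      \bigcap_(i in [set: 'I_n]) ((@tnth n _)^~ i @^-1` B i).
    by apply/seteqP; split=> x /= Ax i => [_|]; exact: Ax.
  apply: fin_bigcap_measurable => // i _.
  by rewrite -[X in measurable X]setTI; exact: measurable_tnth.
have mS t : measurable (S t) by exact: (lphi t).1.
have mI : measurable (unit_itv : set (measurableTypeR R)).
  exact: measurable_itv.
rewrite (eq_integral (fun xi => (\sum_l
    sbm_cond (fun s t => rho * Q s t) l a * \1_(A l) xi)%:E)); last first.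
  move=> xi; rewrite inE => xiI; congr EFin.
  rewrite (@sum_indic_unique _ _ _ _ _ [ffun i => phi (tnth xi i)]).
    by apply: eq_bigr => e _; rewrite !ffunE WQ //; exact: xiI.
  move=> l; split => [Al|->].
    by apply/ffunP => i; rewrite ffunE; have [_ ->] := Al i.
  by move=> i; rewrite ffunE; split => //; exact: xiI.
rewrite integral_finite_sum; last 3 first.
- by apply: (mrect (fun=> unit_itv)) => i.
- by move=> l; apply: (mrect (fun i => S (l i))) => i.
- by move=> l; apply: prodr_ge0 => e _; apply: bernoulli_pmf_ge0.
rewrite /sbm_pmf -sumEFin; apply: eq_bigr => l _.
rewrite setIidl; last by move=> xi Axi i; have [] := Axi i.
rewrite [X in (_ * X = _)%E](_ : _ =
    (\prod_(i < n) uniform_prob (@ltr01 R) (S (l i)))%E); last first.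
  exact: (power_prob_rect _ (fun i => mS (l i))).
rewrite EFinM muleC; congr (_ * _)%E.
rewrite /label_pmf -prodEFin; apply: eq_bigr => i _.
by rewrite uniform_prob_sub; [exact: (lphi _).2|exact: mS|by move=> x []].
Qed.

(** The blocks are laid end to end as half-open intervals of lengths [p t], in the order of
    [enum_rank]; [c] is the cumulative mass. *)
Lemma labeling_exists (R : realType) (T : finType) (p : T -> R) :
  (forall t, 0 <= p t) -> \sum_t p t = 1 -> exists phi, labeling p phi.
Proof.
move=> p0 p1.
have [t0 _] : exists t0 : T, True.
  apply: contrapT => noT; move: p1; rewrite big1 => [/esym/eqP|t _].
    by rewrite oner_eq0.
  by case: noT; exists t.
pose c m : R := \sum_(t : T | (enum_rank t < m)%N) p t.
have c_le i j : (i <= j)%N -> c i <= c j.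
  move=> ij; rewrite /c [leRHS](bigID (fun t => (enum_rank t < i)%N)) /=.
  rewrite -[leLHS]addr0 lerD ?sumr_ge0 //.
  rewrite le_eqVlt; apply/orP; left; apply/eqP; apply: eq_bigl => t.
  by case: (ltnP (enum_rank t) i) => [/leq_trans -> //|]; rewrite ?andbF.
have cS t : c (enum_rank t).+1 = c (enum_rank t) + p t.
  rewrite /c (bigD1 t) /= ?ltnSn // addrC; congr (_ + _).
  apply: eq_bigl => u; rewrite ltnS leq_eqVlt.
  case: eqP => /= [/val_inj/enum_rank_inj ->|ne]; first by rewrite eqxx ltnn.
  by case: eqP ne => [->|]; rewrite ?andbT.
have c0 : c 0 = 0 by rewrite /c big_pred0.
have cT : c #|T| = 1.
  by rewrite -p1 /c; apply: eq_bigl => t; rewrite ltn_ord.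
pose B (t : T) : set R := `]c (enum_rank t), c (enum_rank t).+1]%classic.
have Buniq s t x : B s x -> B t x -> s = t.
  rewrite /B /= !in_itv/= => /andP[s1 s2] /andP[t1 t2].
  apply/enum_rank_inj/val_inj/eqP; rewrite eqn_leq leqNgt [X in _ && X]leqNgt.
  apply/andP; split; apply/negP => /c_le.
    by rewrite leNgt (lt_le_trans s1 t2).
  by rewrite leNgt (lt_le_trans t1 s2).
have Bex x : 0 < x <= 1 -> exists t, B t x.
  move=> /andP[x0 x1].
  have exm : exists m, x <= c m by exists #|T|; rewrite cT.
  case: (ex_minnP exm) => -[|m]; first by rewrite c0 leNgt x0.
  move=> xm mmin.
  have cm : c m < x by rewrite ltNge; apply/negP => /mmin; rewrite ltnn.
  have mT : (m < #|T|)%N.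
    rewrite ltnNge; apply/negP => /c_le; rewrite cT leNgt.
    by rewrite (lt_le_trans cm x1).
  by exists (enum_val (Ordinal mT)); rewrite /B /= in_itv/= enum_valK /= cm.
have c01 m : 0 <= c m <= 1.
  rewrite sumr_ge0 //= -p1 /c [leRHS](bigID (fun t => (enum_rank t < m)%N)) /=.
  by rewrite lerDl sumr_ge0.
(* Within the unit interval only the point 0 lies in no [B t]; it gets the default label [t0], at no
   cost in measure. *)
pose phi x := if [pick t | `[< B t x >]] is Some t then t else t0.
have phiB t x : B t x -> phi x = t.
  rewrite /phi => Btx; case: pickP => [s /asboolP Bsx|/(_ t)].
    exact: Buniq Bsx Btx.
  by move/asboolP.
have BI t : B t `<=` unit_itv.
  move=> x; rewrite /B /unit_itv/= !in_itv/= => /andP[x1 x2].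
  have /andP[y1 _] := c01 (enum_rank t); have /andP[_ y2] := c01 (enum_rank t).+1.
  by rewrite (le_trans y1 (ltW x1)) (le_trans x2 y2).
have phi0 t : ~ B t 0.
  rewrite /B/= in_itv/= => /andP[].
  by have /andP[y1 _] := c01 (enum_rank t); rewrite ltNge y1.
have E t : unit_itv `&` phi @^-1` [set t] =
    B t `|` (if t == t0 then [set 0] else set0).
  apply/seteqP; split => x.
    move=> [/= xI <-]; have [->|x0] := eqVneq x 0.
      right; rewrite /phi; case: pickP => [s /asboolP/phi0 //|_].
      by rewrite eqxx.
    left; have [|s Bs] := Bex x; last by rewrite (phiB _ _ Bs).
    move: xI; rewrite /unit_itv/= in_itv/= => /andP[x0' ->].
    by rewrite lt_neqAle eq_sym x0 x0'.
  move=> [Btx|]; first by split; [exact: BI Btx|exact: phiB].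
  case: eqP => // -> /= ->; split.
    by rewrite /unit_itv/= in_itv/= lexx ler01.
  by rewrite /phi; case: pickP => // s /asboolP/phi0.
have mZ t : measurable (if t == t0 then [set 0] else set0 : set R).
  by case: eqP => // _; exact: measurable_set1.
have mB t : measurable (B t) by exact: measurable_itv.
have muB t : lebesgue_measure (B t) = (p t)%:E.
  rewrite lebesgue_measure_itv /= lte_fin cS ltrDl.
  case: ltgtP (p0 t) => // [_ _|<- _].
    by rewrite -EFinB addrAC subrr add0r.
  by [].
have muZ t : lebesgue_measure (if t == t0 then [set 0] else set0 : set R) = 0%E.
  by case: eqP => // _; exact: lebesgue_measure_set1.
exists phi => t; rewrite E; split; first exact: measurableU.
rewrite -[RHS]adde0 -muB -(muZ t); apply: measureU; [exact: mB|exact: mZ|].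
apply/seteqP; split => // x [Btx]; case: eqP => // _ x0; rewrite x0 in Btx.
exact: phi0 Btx.
Qed.

(** * Couplings from the invariant distance *)

Definition coupling (R : realType) (T : finType) (p1 p2 : T -> R)
    (w : T -> T -> R) :=
  [/\ forall s t, 0 <= w s t, forall s, \sum_t w s t = p1 s
    & forall t, \sum_s w s t = p2 t].

(** The squared L2 distance of two step functions when [w] is the joint law of their two labels at a
    uniform point; the two coordinates of the square are independent, hence the product of
    weights. *)
Definition coupling_loss (R : realType) (T : finType) (Q1 Q2 : T -> T -> R)
    (w : T -> T -> R) : R :=
  \sum_(u : T * T) \sum_(v : T * T)
    w u.1 u.2 * w v.1 v.2 * (Q1 u.1 v.1 - Q2 u.2 v.2) ^+ 2.

(** [w] is the joint law of the pair of labels given by [s] and [t]; the marginals are right because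
    the cells of one partition cut those of the other into disjoint pieces. *)
Lemma partition_coupling (R : realType) (T : finType) (p1 p2 : T -> R)
    (s t : R -> T) :
  let I : set R := `]0, 1[%classic in
  let S a := I `&` s @^-1` [set a] in
  let U a := I `&` t @^-1` [set a] in
  (forall a, measurable (S a) /\ lebesgue_measure (S a) = (p1 a)%:E) ->
  (forall a, measurable (U a) /\ lebesgue_measure (U a) = (p2 a)%:E) ->
  exists w, coupling p1 p2 w /\
    forall a c, lebesgue_measure (S a `&` U c) = (w a c)%:E.
Proof.
move=> I S U mS mU.
have mSU a c : measurable (S a `&` U c).
  by apply: measurableI; [exact: (mS a).1|exact: (mU c).1].
have mI : measurable I by exact: measurable_itv.
have E a c : lebesgue_measure (S a `&` U c) =
    (fine (lebesgue_measure (S a `&` U c)))%:E.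
  rewrite fineK // ge0_fin_numE //.
  rewrite (@le_lt_trans _ _ (lebesgue_measure (S a))) //.
    by apply: le_measure; rewrite ?inE; [exact: mSU|exact: (mS a).1|move=> x []].
  by rewrite (mS a).2 ltry.
exists (fun a c => fine (lebesgue_measure (S a `&` U c))); split=> //; split.
- by move=> a c; exact: fine_ge0.
- move=> a; apply: EFin_inj; rewrite -sumEFin -(mS a).2.
  under eq_bigr do rewrite -E.
  have /= := @integral_finite_sum _ _ R lebesgue_measure I T
    (fun c => S a `&` U c) (fun=> 1) mI (mSU a) (fun=> ler01).
  under [RHS]eq_bigr => c _.
    rewrite mul1e (setIidl (_ : S a `&` U c `<=` I)); last by move=> x [[]].
    over.
  move=> <-; rewrite -[in RHS](setIidl (_ : S a `<=` I)); last by move=> x [].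
  rewrite -integral_indic //; last exact: (mS a).1.
  apply: eq_integral => x; rewrite inE => Ix; congr EFin.
  have [Sax|nSax] := pselect (S a x).
    rewrite [RHS]indicE mem_set // (@sum_indic_unique _ _ _ _ _ (t x)) //.
    move=> c; split => [[_ [_ <-]] //|->].
    by split.
  rewrite [RHS]indicE memNset // big1 // => c _.
  by rewrite indicE memNset ?mulr0 // => -[].
- move=> c; apply: EFin_inj; rewrite -sumEFin -(mU c).2.
  under eq_bigr do rewrite -E.
  have /= := @integral_finite_sum _ _ R lebesgue_measure I T
    (fun a => S a `&` U c) (fun=> 1) mI (fun a => mSU a c) (fun=> ler01).
  under [RHS]eq_bigr => a _.
    rewrite mul1e (setIidl (_ : S a `&` U c `<=` I)); last by move=> x [[]].
    over.
  move=> <-; rewrite -[in RHS](setIidl (_ : U c `<=` I)); last by move=> x [].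
  rewrite -integral_indic //; last exact: (mU c).1.
  apply: eq_integral => x; rewrite inE => Ix; congr EFin.
  have [Ucx|nUcx] := pselect (U c x).
    rewrite [RHS]indicE mem_set // (@sum_indic_unique _ _ _ _ _ (s x)) //.
    move=> a; split => [[[_ <-]] //|->].
    by split.
  rewrite [RHS]indicE memNset // big1 // => a _.
  by rewrite indicE memNset ?mulr0 // => -[].
Qed.

Lemma measurable_step (R : realType) (T : finType) (I : set R) (s : R -> T)
    (Q : T -> T -> R) :
  (forall a, measurable (I `&` s @^-1` [set a])) ->
  measurable_fun (I `*` I) (fun z : R * R => Q (s z.1) (s z.2)).
Proof.
move=> mS.
apply: (@eq_measurable_fun _ _ _ _ _ (fun z : R * R => \sum_(u : T * T)
    Q u.1 u.2 * \1_((I `&` s @^-1` [set u.1]) `*` (I `&` s @^-1` [set u.2])) z)).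
  move=> [x y]; rewrite inE => -[/= Ix Iy].
  rewrite (@sum_indic_unique _ _ _ _ _ (s x, s y)) // => -[a b]; split.
    by move=> [/= [_ <-] [_ <-]].
  by move=> [-> ->].
apply: measurable_sum => u; apply: measurable_funM => //.
by apply: measurable_indic; exact: measurableX.
Qed.

(** The loss is exactly the squared distance of the two step functions. Passing through [f] with (x
    - y)^2 <= 2 ((x - c)^2 + (y - c)^2) bounds it by 2 (r + r). *)
Lemma step_coupling (R : realType) (T : finType) (p1 p2 : T -> R)
    (s t : R -> T) (Q1 Q2 : T -> T -> R) (f : R * R -> R) (r : R) :
  let I : set R := `]0, 1[%classic in
  let S a := I `&` s @^-1` [set a] in
  let U a := I `&` t @^-1` [set a] in
  let L h := (\int[lebesgue_measure \x lebesgue_measure]_(z in I `*` I)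
     ((h z - f z) ^+ 2)%:E)%E in
  (forall a, measurable (S a) /\ lebesgue_measure (S a) = (p1 a)%:E) ->
  (forall a, measurable (U a) /\ lebesgue_measure (U a) = (p2 a)%:E) ->
  measurable_fun (I `*` I) f ->
  (L (fun z => Q1 (s z.1) (s z.2)) < r%:E)%E ->
  (L (fun z => Q2 (t z.1) (t z.2)) < r%:E)%E ->
  exists w, coupling p1 p2 w /\ coupling_loss Q1 Q2 w < 4 * r.
Proof.
move=> I S U L mS mU mf L1 L2.
have [w [cw wE']] := partition_coupling mS mU; exists w; split=> //.
have wE a c : lebesgue_measure (S a `&` U c) = (w a c)%:E := wE' a c.
have mI : measurable I by exact: measurable_itv.
have mII : measurable (I `*` I) by exact: measurableX.
have m1 := measurable_step Q1 (fun a => (mS a).1).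
have m2 := measurable_step Q2 (fun a => (mU a).1).
set h1 := (X in measurable_fun _ X) in m1; set h2 := (X in measurable_fun _ X) in m2.
have mL (h : R * R -> R) : measurable_fun (I `*` I) h ->
    measurable_fun (I `*` I) (EFin \o (fun z : R * R => (h z - f z) ^+ 2)).
  move=> mh; apply/measurable_EFinP; apply: measurable_funX.
  exact: measurable_funB.
pose A (u : (T * T) * (T * T)) := (S u.1.1 `&` U u.1.2) `*` (S u.2.1 `&` U u.2.2).
have mSU a c : measurable (S a `&` U c).
  by apply: measurableI; [exact: (mS a).1|exact: (mU c).1].
have lossE : ((coupling_loss Q1 Q2 w)%:E =
    \int[lebesgue_measure \x lebesgue_measure]_(z in I `*` I)
      ((h1 z - h2 z) ^+ 2)%:E)%E.
  rewrite /coupling_loss pair_bigA /=.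
  transitivity (\int[lebesgue_measure \x lebesgue_measure]_(z in I `*` I)
     (\sum_(u : (T * T) * (T * T))
       (Q1 u.1.1 u.2.1 - Q2 u.1.2 u.2.2) ^+ 2 * \1_(A u) z)%:E)%E.
    rewrite integral_finite_sum //; last 2 first.
    - by move=> u; apply: measurableX; exact: mSU.
    - by move=> u; exact: sqr_ge0.
    rewrite -sumEFin; apply: eq_bigr => u _.
    rewrite setIidl; last by move=> z [[[? _] _] [[? _] _]].
    rewrite [X in (_ = _ * X)%E](_ : _ = (w u.1.1 u.1.2 * w u.2.1 u.2.2)%:E).
      by rewrite -EFinM mulrC.
    transitivity (lebesgue_measure (S u.1.1 `&` U u.1.2) *
                  lebesgue_measure (S u.2.1 `&` U u.2.2))%E.
      by apply: product_measure1E; exact: mSU.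
    by rewrite !wE -EFinM.
  apply: eq_integral => -[x y]; rewrite inE => -[/= Ix Iy].
  rewrite (@sum_indic_unique _ _ _ _ _ ((s x, t x), (s y, t y))) //.
  move=> [[a c] [b d]]; split.
    by move=> [/= [[_ <-] [_ <-]] [[_ <-] [_ <-]]].
  by move=> [-> -> -> ->].
rewrite -lte_fin lossE.
apply: (@le_lt_trans _ _ (2%:E * (L h1 + L h2))%E).
  rewrite /L -ge0_integralD //; last 4 first.
  - by move=> z _; rewrite lee_fin sqr_ge0.
  - exact: mL.
  - by move=> z _; rewrite lee_fin sqr_ge0.
  - exact: mL.
  rewrite -ge0_integralZl //.
  - apply: ge0_le_integral => //.
    + by move=> z _; rewrite lee_fin sqr_ge0.
    + apply/measurable_EFinP; apply: measurable_funX; exact: measurable_funB.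
    + apply: measurable_funeM; apply: emeasurable_funD; exact: mL.
    + move=> z _; rewrite -EFinD -EFinM lee_fin.
      have sqP (x y c : R) : (x - y) ^+ 2 <= 2 * ((x - c) ^+ 2 + (y - c) ^+ 2).
        rewrite -subr_ge0 (_ : _ - _ = (x + y - 2 * c) ^+ 2) ?sqr_ge0 //.
        by ring.
      exact: sqP.
  - by apply: emeasurable_funD; exact: mL.
  - by move=> z _; rewrite -EFinD lee_fin addr_ge0 ?sqr_ge0.
have L0 h : (0 <= L h)%E by apply: integral_ge0 => z _; rewrite lee_fin sqr_ge0.
move: (L0 h1) (L0 h2) L1 L2; rewrite -/h1 -/h2.
case: (L h1) => [x1||] //; case: (L h2) => [x2||] // _ _.
rewrite !lte_fin => x1r x2r.
suff : (2%:E * (x1%:E + x2%:E) < (4 * r)%:E)%E by [].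
by rewrite -EFinD -EFinM lte_fin; lra.
Qed.

Lemma oo_sub_unit (R : realType) : `]0, 1[%classic `<=` (unit_itv : set R).
Proof.
by move=> x; rewrite /unit_itv/= !in_itv/= => /andP[/ltW -> /ltW ->].
Qed.

(** Reconciles the open square over which the loss is integrated with labelings of the closed
    interval: the two end points are null. *)
Lemma lebesgue_measure_oo (R : realType) (B : set R) :
  measurable B -> B `<=` unit_itv ->
  lebesgue_measure (`]0, 1[ `&` B) = lebesgue_measure B.
Proof.
move=> mB BI.
have mI : measurable (`]0, 1[%classic : set R) by exact: measurable_itv.
have mZ : measurable ([set 0] `|` [set 1] : set R).
  by apply: measurableU; exact: measurable_set1.
have E : B = (`]0, 1[ `&` B) `|` (B `&` ([set 0] `|` [set 1])).
  apply/seteqP; split => [x Bx|x [[]//|[]//]].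
  have := BI _ Bx; rewrite /unit_itv/= in_itv/= => /andP[x0 x1].
  have [x0'|n0] := eqVneq x 0; first by right; split=> //; left.
  have [x1'|n1] := eqVneq x 1; first by right; split=> //; right.
  by left; split=> //=; rewrite in_itv/= !lt_neqAle eq_sym n0 x0 n1 x1.
have Z0 : lebesgue_measure (B `&` ([set 0] `|` [set 1])) = 0%E.
  apply/countable_lebesgue_measure0/finite_set_countable.
  by apply: sub_finite_set (@subIsetr _ _ _) _; rewrite finite_setU.
rewrite [in RHS]E -[LHS]adde0 -Z0; apply/esym/measureU.
- exact: measurableI.
- exact: measurableI.
- apply/seteqP; split => // x [[/= xI _] [_]]; move: xI; rewrite in_itv/=.
  by move=> /andP[x0 x1] [] xe; move: x0 x1; rewrite xe ltxx.
Qed.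

(** A bijection [tau] that nearly attains the infimum turns [phi] into the labels [phi \o tau],
    whose block masses are the same because [tau] preserves measure. *)
Lemma delta2_step (R : realType) (T : finType) (p : T -> R) (phi : R -> T)
    (Q : T -> T -> R) (W f : R * R -> R) (rho r : R) :
  let I : set R := `]0, 1[%classic in
  labeling p phi ->
  (forall x y, unit_itv x -> unit_itv y -> W (x, y) = Q (phi x) (phi y)) ->
  (delta2 f (fun z => rho * W z)%R < r%:E)%E ->
  exists s : R -> T, (forall a, measurable (I `&` s @^-1` [set a]) /\
      lebesgue_measure (I `&` s @^-1` [set a]) = (p a)%:E) /\
    (\int[lebesgue_measure \x lebesgue_measure]_(z in I `*` I)
     ((rho * Q (s z.1) (s z.2) - f z) ^+ 2)%:E < r%:E)%E.
Proof.
move=> I lphi WQ /ereal_inf_lt[_ [tau [[tauI _ taui] mtau tauE] <-]] Lr.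
have tI x : unit_itv x -> unit_itv (tau x) by exact: tauI.
exists (phi \o tau); split => [a|].
  have [mB muB] := lphi a; set B := _ `&` _ in mB muB.
  have E : I `&` (phi \o tau) @^-1` [set a] = I `&` (unit_itv `&` tau @^-1` B).
    apply/seteqP; split => x [/= Ix].
      move=> ptx; split=> //; split; first exact: oo_sub_unit.
      by split=> //; apply: tI; exact: oo_sub_unit.
    by move=> [_ [_ ptx]].
  have mtB : measurable (unit_itv `&` tau @^-1` B).
    by apply: mtau => //; exact: measurable_itv.
  rewrite E; split; first by apply: measurableI => //; exact: measurable_itv.
  rewrite lebesgue_measure_oo //.
  by rewrite -muB; apply: tauE => // x [].
apply: le_lt_trans Lr; rewrite le_eqVlt; apply/orP; left; apply/eqP.
apply: eq_integral => -[x y]; rewrite inE => -[/= Ix Iy].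
rewrite real_normK ?num_real // WQ //; by apply: tI; exact: oo_sub_unit.
Qed.

Lemma coupling_lossZ (R : realType) (T : finType) (Q1 Q2 : T -> T -> R) w rho :
  coupling_loss (fun s t => rho * Q1 s t) (fun s t => rho * Q2 s t) w =
  rho ^+ 2 * coupling_loss Q1 Q2 w.
Proof.
rewrite /coupling_loss mulr_sumr; apply: eq_bigr => u _.
rewrite mulr_sumr; apply: eq_bigr => v _.
by rewrite -mulrBr exprMn mulrCA.
Qed.

Lemma delta2_coupling (R : realType) (T : finType) (p1 p2 : T -> R)
    (phi1 phi2 : R -> T) (Q1 Q2 : T -> T -> R) (W1 W2 f : R * R -> R)
    (rho r : R) :
  labeling p1 phi1 -> labeling p2 phi2 ->
  (forall x y, unit_itv x -> unit_itv y -> W1 (x, y) = Q1 (phi1 x) (phi1 y)) ->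
  (forall x y, unit_itv x -> unit_itv y -> W2 (x, y) = Q2 (phi2 x) (phi2 y)) ->
  measurable_fun (unit_itv `*` unit_itv) f ->
  (delta2 f (fun z => rho * W1 z)%R < r%:E)%E ->
  (delta2 f (fun z => rho * W2 z)%R < r%:E)%E ->
  exists w, coupling p1 p2 w /\ rho ^+ 2 * coupling_loss Q1 Q2 w < 4 * r.
Proof.
move=> l1 l2 WQ1 WQ2 mf d1 d2.
have [s [sp Ls]] := delta2_step l1 WQ1 d1.
have [t [tp Lt]] := delta2_step l2 WQ2 d2.
pose I : set R := `]0, 1[%classic.
have mf' : measurable_fun (I `*` I) f.
  apply: measurable_funS mf.
    by apply: measurableX; exact: measurable_itv.
  by move=> z [z1 z2]; split; exact: oo_sub_unit.
have [w [cw Lw]] := @step_coupling R T p1 p2 s t (fun a b => rho * Q1 a b)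
  (fun a b => rho * Q2 a b) f r sp tp mf' Ls Lt.
by exists w; split; rewrite // -coupling_lossZ.
Qed.

(** * Reduction to list decoding *)

Lemma step_graphon_labeling (R : realType) (T : finType) (k : nat)
    (p : T -> R) (phi : R -> T) (Q : T -> T -> R) :
  labeling p phi -> (#|T| <= k)%N -> (forall s t, Q s t = Q t s) ->
  (forall s t, 0 <= Q s t <= 1) ->
  step_graphon k (fun z : R * R => Q (phi z.1) (phi z.2)).
Proof.
move=> lphi Tk Qsym Q01; split.
  split => [|x y _ _|x y _ _]; [|exact: Qsym|exact: Q01].
  exact: (measurable_step Q (fun a => (lphi a).1)).
(* Indices from [#|T|] on are values of [phi'] at no point; there [phi 0] merely serves as some
   element of [T]. *)
pose f (i : 'I_k) : T :=
  if insub (i : nat) is Some j then enum_val (j : 'I_#|T|) else phi 0.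
pose phi' x : 'I_k := widen_ord Tk (enum_rank (phi x)).
have fK x : f (phi' x) = phi x.
  by rewrite /f /phi' /= (valK (enum_rank (phi x))) enum_rankK.
exists (\matrix_(i, j) Q (f i) (f j)), phi'; split.
- by apply/matrixP => i j; rewrite !mxE Qsym.
- move=> a; have [[t ->]|na] := pselect (exists t, a = widen_ord Tk (enum_rank t)).
    rewrite (_ : _ `&` _ = unit_itv `&` phi @^-1` [set t]); first exact: (lphi t).1.
    apply/seteqP; split=> x [xI /= e]; split=> //=; last by rewrite /phi' e.
    by apply: enum_rank_inj; apply: val_inj; move/(congr1 val): e.
  rewrite (_ : _ `&` _ = set0) //; apply/seteqP; split => // x [_ /= e].
  by apply: na; exists (phi x); rewrite -e.
- by move=> x y _ _; rewrite mxE !fK.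
Qed.

Lemma bernoulli_sum1 (R : realType) (p : R) : \sum_b bernoulli_pmf p b = 1.
Proof. by rewrite big_bool /bernoulli_pmf /= addrC subrK. Qed.

Lemma sbm_cond_sum1 (R : realType) (T : finType) n (Q : T -> T -> R)
  (l : {ffun 'I_n -> T}) : \sum_a sbm_cond Q l a = 1.
Proof.
rewrite /sbm_cond -(bigA_distr_bigA
  (fun e b => bernoulli_pmf (Q (l (val e).1) (l (val e).2)) b)) /=.
by rewrite big1 // => e _; rewrite bernoulli_sum1.
Qed.

Lemma label_pmf_sum1 (R : realType) (T : finType) n (p : T -> R) :
  \sum_t p t = 1 -> \sum_(l : {ffun 'I_n -> T}) label_pmf p l = 1.
Proof.
move=> p1; rewrite /label_pmf -(bigA_distr_bigA (fun _ t => p t)) /=.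
by rewrite big1.
Qed.

Lemma sbm_pmf_sum1 (R : realType) (T : finType) n (p : T -> R)
    (Q : T -> T -> R) :
  \sum_t p t = 1 -> \sum_(a : observation n) sbm_pmf p Q a = 1.
Proof.
move=> p1; rewrite exchange_big /= -(label_pmf_sum1 n p1).
by apply: eq_bigr => l _; rewrite -mulr_sumr sbm_cond_sum1 mulr1.
Qed.

Lemma sbm_cond_ge0 (R : realType) (T : finType) n (Q : T -> T -> R)
    (l : {ffun 'I_n -> T}) a :
  (forall s t, 0 <= Q s t <= 1) -> 0 <= sbm_cond Q l a.
Proof. by move=> Q01; apply: prodr_ge0 => e _; exact: bernoulli_pmf_ge0. Qed.

Lemma label_pmf_ge0 (R : realType) (T : finType) n (p : T -> R)
  (l : {ffun 'I_n -> T}) : (forall t, 0 <= p t) -> 0 <= label_pmf p l.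
Proof. by move=> p0; apply: prodr_ge0. Qed.

Lemma sbm_pmf_ge0 (R : realType) (T : finType) n (p : T -> R)
    (Q : T -> T -> R) (a : observation n) :
  (forall t, 0 <= p t) -> (forall s t, 0 <= Q s t <= 1) -> 0 <= sbm_pmf p Q a.
Proof.
move=> p0 Q01; apply: sumr_ge0 => l _.
by rewrite mulr_ge0 ?label_pmf_ge0 ?sbm_cond_ge0.
Qed.

(** Nearness up to rearrangement, expressed by couplings alone, so that the rest of the argument is
    finite combinatorics. *)
Definition sbm_close (R : realType) (T : finType) (p1 p2 : T -> R)
    (Q1 Q2 : T -> T -> R) (r : R) :=
  exists w, coupling p1 p2 w /\ coupling_loss Q1 Q2 w < r.

Lemma delta2_ge0 (R : realType) (f f0 : R * R -> R) : (0 <= delta2 f f0)%E.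
Proof.
apply/ereal_infP => _ [tau _ <-]; apply: integral_ge0 => z _.
by rewrite lee_fin exprn_ge0.
Qed.

(* List-decoding version of Fano's inequality, with the likelihood ratios
   controlled against one common reference [q]. *)
Lemma minimax_list_bound (R : realType) (Th T : finType) (p : Th -> T -> R)
    (Q : Th -> T -> T -> R) (rho r c G L : R) (k n : nat)
    (q : observation n -> R) (g : Th -> observation n -> R) :
  (0 < #|Th|)%N -> (#|T| <= k)%N -> 0 < rho <= 1 -> 0 <= r -> 0 <= c ->
  (forall th t, 0 <= p th t) -> (forall th, \sum_t p th t = 1) ->
  (forall th s t, Q th s t = Q th t s) ->
  (forall th s t, 0 <= Q th s t <= 1) ->
  (forall a, 0 <= q a) -> \sum_a q a = 1 ->
  (forall th a, 0 <= g th a) -> (forall th, \sum_a g th a <= G) ->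
  (forall th a, sbm_pmf (p th) (fun s t => rho * Q th s t) a
     <= c * q a + g th a) ->
  (forall th0, #|[pred th | `[< sbm_close (p th) (p th0) (Q th) (Q th0)
     (4 * r / rho ^+ 2) >]]|%:R <= L) ->
  ((r * (1 - G - c * L / #|Th|%:R))%:E <= minimax_risk n k rho)%E.
Proof.
move=> Th0 Tk /andP[rho0 rho1] r0 c0 p0 p1 Qsym Q01 q0 q1 g0 gG Pq closeL.
have /choice[phi lphi] th : exists phi, labeling (p th) phi.
  by apply: labeling_exists.
apply/ereal_infP => _ [f fest <-].
pose W th (z : R * R) := Q th (phi th z.1) (phi th z.2).
have rQ01 th s t : 0 <= rho * Q th s t <= 1.
  have /andP[? ?] := Q01 th s t.
  by rewrite mulr_ge0 ?(ltW rho0) //= mulr_ile1 // ltW.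
have WS th : step_graphon k (W th) by apply: step_graphon_labeling (lphi th) _ _ _.
pose good th a := `[< (delta2 (f a) (fun z => rho * W th z)%R < r%:E)%E >].
pose P th (a : observation n) := sbm_pmf (p th) (fun s t => rho * Q th s t) a.
have P0 th a : 0 <= P th a by apply: sbm_pmf_ge0.
(* By [delta2_coupling], all members approximated by [f a] are close to any one of them. If there is
   none, [L] is still nonnegative, as a bound on a cardinality. *)
have goodL a : (\sum_th good th a)%:R <= L.
  have [[th0 gth0]|ng] := pselect (exists th0, good th0 a); last first.
    rewrite big1; first by have /card_gt0P[th _] := Th0; apply: le_trans (closeL th).
    by move=> th _; case gth: (good th a) => //; case: ng; exists th.
  apply: le_trans (closeL th0); rewrite ler_nat -sum1_card [leqRHS]big_mkcond /=.
  apply: leq_sum => th _; case gth: (good th a) => //.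
  rewrite ifT //; apply/asboolP.
  have [mf _] := fest a.
  have [w [cw Lw]] := @delta2_coupling R T _ _ _ _ (Q th) (Q th0)
    (W th) (W th0) _ _ _ (lphi th) (lphi th0) (fun x y _ _ => erefl)
    (fun x y _ _ => erefl) mf (asboolW gth) (asboolW gth0).
  by exists w; split=> //; rewrite ltr_pdivlMr ?exprn_gt0 // mulrC.
(* The [q] part is summed over the family first, where at most [L] members are good for each
   observation; the [g] part costs at most [G] per member. *)
have Tcount : \sum_th \sum_a P th a * (good th a)%:R <= c * L + #|Th|%:R * G.
  apply: (@le_trans _ _ (\sum_th \sum_a (c * q a * (good th a)%:R + g th a))).
    apply: ler_sum => th _; apply: ler_sum => a _.
    apply: le_trans (ler_wpM2r (ler0n _ _) (Pq th a)) _.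
    by case: (good th a); rewrite ?mulr1 // !mulr0 add0r.
  under eq_bigr do rewrite big_split /=.
  rewrite big_split /= lerD //.
    rewrite exchange_big /=.
    apply: (@le_trans _ _ (\sum_a c * q a * L)).
      apply: ler_sum => a _; rewrite -mulr_sumr ler_wpM2l ?mulr_ge0 //.
      by rewrite -natr_sum.
    by rewrite -mulr_suml -mulr_sumr q1 mulr1.
  by rewrite mulr_natl -sumr_const; exact: ler_sum.
have N0 : 0 < #|Th|%:R :> R by rewrite ltr0n.
(* Some member has a success probability at most the average over the family. *)
have [th Pth] : exists th, \sum_a P th a * (good th a)%:R <=
    G + c * L / #|Th|%:R.
  apply: contrapT => /forallNP nP; move: Tcount; apply/negP; rewrite -ltNge.
  have -> : c * L + #|Th|%:R * G = \sum_(th : Th) (G + c * L / #|Th|%:R).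
    by rewrite sumr_const -[RHS]mulr_natl mulrDr mulrCA divff ?gt_eqF // mulr1 addrC.
  have /card_gt0P[th1 _] := Th0.
  rewrite [ltLHS](bigD1 th1) // [ltRHS](bigD1 th1) //=.
  by rewrite ltr_leD ?ler_sum // => [|th _]; [|apply: ltW]; rewrite ltNge;
    apply/negP/nP.
apply: (@le_trans _ _ (risk rho (W th) f)); last first.
  by apply: ereal_sup_ubound; exists (W th).
rewrite /risk /expect.
(* Markov's bound: off the good event the loss is at least [r]. *)
apply: (@le_trans _ _ (\sum_a (P th a * (r * (1 - (good th a)%:R)))%:E)%E).
  rewrite sumEFin lee_fin.
  under eq_bigr do rewrite mulrCA mulrBr mulr1.
  rewrite -mulr_sumr big_split /= sumrN /P sbm_pmf_sum1 // ler_wpM2l //.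
  by rewrite -addrA -opprD lerB.
apply: lee_sum => a _.
rewrite (@obs_pmf_sbm R T n (p th) (phi th) (Q th)) // EFinM.
apply: lee_wpmul2l; first by rewrite lee_fin P0.
case gth: (good th a); first by rewrite subrr mulr0 delta2_ge0.
by rewrite subr0 mulr1 leNgt; apply/negP => /asboolT; rewrite -/(good th a) gth.
Qed.

(** * Likelihood ratios *)

(** The difference of the two sides is a perfect square over a positive number. Applied to a law [p]
    and a reference [q], it makes the second moment of the likelihood ratio the size of the error
    term. *)
Lemma le_linear_quadratic (R : realFieldType) (c p q : R) : 0 < c -> 0 < q ->
  p <= c * q + p ^+ 2 / (4 * c * q).
Proof.
move=> c0 q0; rewrite -subr_ge0.
rewrite (_ : _ - _ = (p - 2 * c * q) ^+ 2 / (4 * c * q)); last first.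
  by field; rewrite !gt_eqF.
by rewrite divr_ge0 ?sqr_ge0 // !mulr_ge0 // ltW.
Qed.

Lemma sum_label_pmf (R : realType) (T : finType) n (p : T -> R) :
  \sum_(l : {ffun 'I_n -> T}) label_pmf p l = (\sum_t p t) ^+ n.
Proof.
rewrite /label_pmf -(bigA_distr_bigA (fun (_ : 'I_n) t => p t)) /=.
by rewrite prodr_const card_ord.
Qed.

(** When only the block masses differ, [le_linear_quadratic] is applied to each label vector before
    averaging over edges; the second moment is then the [n]-th power of that of one label. *)
Lemma sbm_pmf_le_labels (R : realType) (T : finType) n (p0 p : T -> R)
    (Q : T -> T -> R) (c : R) :
  0 < c -> (forall t, 0 < p0 t) -> (forall t, 0 <= p t) ->
  (forall s t, 0 <= Q s t <= 1) ->
  exists g : observation n -> R, [/\ forall a, 0 <= g a,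
    \sum_a g a = (\sum_t p t ^+ 2 / p0 t) ^+ n / (4 * c)
  & forall a, sbm_pmf p Q a <= c * sbm_pmf p0 Q a + g a].
Proof.
move=> c0 pp0 p0' Q01.
have l0 (l : {ffun 'I_n -> T}) : 0 < label_pmf p0 l by apply: prodr_gt0.
exists (fun a => \sum_(l : {ffun 'I_n -> T})
  (label_pmf p l ^+ 2 / (4 * c * label_pmf p0 l)) * sbm_cond Q l a); split.
- move=> a; apply: sumr_ge0 => l _; rewrite mulr_ge0 ?sbm_cond_ge0 //.
  by rewrite divr_ge0 ?sqr_ge0 // !mulr_ge0 // ltW.
- rewrite exchange_big /= -sum_label_pmf mulr_suml; apply: eq_bigr => l _.
  rewrite -mulr_sumr sbm_cond_sum1 mulr1.
  rewrite invfM [(4 * c)^-1 * _]mulrC mulrA; congr (_ / _).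
  by rewrite /label_pmf -prodrXl -prodfV -big_split.
- move=> a; rewrite mulr_sumr -big_split /=; apply: ler_sum => l _.
  rewrite mulrA -mulrDl ler_wpM2r ?sbm_cond_ge0 //.
  exact: le_linear_quadratic.
Qed.

Definition null_pmf (R : realType) n (p : R) (a : observation n) : R :=
  \prod_(e : edge n) bernoulli_pmf p (a e).

Lemma null_pmf_gt0 (R : realType) n (p : R) (a : observation n) :
  0 < p < 1 -> 0 < null_pmf p a.
Proof.
move=> /andP[p0 p1]; apply: prodr_gt0 => e _.
by rewrite /bernoulli_pmf; case: (a e); rewrite ?subr_gt0.
Qed.

Lemma null_pmf_sum1 (R : realType) n (p : R) :
  \sum_(a : observation n) null_pmf p a = 1.
Proof.
rewrite /null_pmf -(bigA_distr_bigA (fun _ b => bernoulli_pmf p b)) /=.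
by rewrite big1 // => e _; rewrite bernoulli_sum1.
Qed.

(** A relative perturbation of the constant 1/2, so that [rho * signal] has the form [p * (1 + a)]
    of [bernoulli_chi2] with [p = rho / 2]. *)
Definition signal (R : realType) (T : Type) (eps : R) (x : T -> T -> R) s t : R :=
  2^-1 * (1 + eps * x s t).

Lemma bernoulli_chi2 (R : realType) (p a b : R) : 0 < p < 1 ->
  \sum_i bernoulli_pmf (p * (1 + a)) i * bernoulli_pmf (p * (1 + b)) i
    / bernoulli_pmf p i = 1 + p / (1 - p) * (a * b).
Proof.
move=> /andP[p0 p1]; rewrite big_bool /bernoulli_pmf /=.
by field; rewrite subr_eq0 !gt_eqF.
Qed.

(** Squaring the mixture introduces two independent label vectors [l] and [m]; given both, the sum
    over observations factors over the edges into instances of [bernoulli_chi2]. *)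
Lemma sbm_pmf_le_null (R : realType) (T : finType) n (p : T -> R)
    (rho eps c : R) (x : T -> T -> R) :
  0 < c -> 0 < rho <= 1 -> (forall t, 0 <= p t) ->
  exists g : observation n -> R, [/\ forall a, 0 <= g a,
    \sum_a g a = (4 * c)^-1 * \sum_(l : {ffun 'I_n -> T})
       \sum_(m : {ffun 'I_n -> T}) label_pmf p l * label_pmf p m *
      \prod_(e : edge n) (1 + (rho / 2) / (1 - rho / 2) * eps ^+ 2 *
         (x (l (val e).1) (l (val e).2) * x (m (val e).1) (m (val e).2)))
  & forall a, sbm_pmf p (fun s t => rho * signal eps x s t) a
      <= c * null_pmf (rho / 2) a + g a].
Proof.
move=> c0 /andP[rho0 rho1] p0; set q := rho / 2.
have q01 : 0 < q < 1 by rewrite /q; apply/andP; split; lra.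
set P := sbm_pmf p _.
have n0 (a : observation n) := null_pmf_gt0 a q01.
exists (fun a => P a ^+ 2 / (4 * c * null_pmf q a)); split.
- by move=> a; rewrite divr_ge0 ?sqr_ge0 // !mulr_ge0 // ltW.
- under eq_bigr do rewrite invfM mulrCA.
  rewrite -mulr_sumr; congr (_ * _).
  rewrite /P /sbm_pmf.
  under eq_bigr do rewrite expr2 mulr_suml mulr_suml.
  rewrite exchange_big /=; apply: eq_bigr => l _.
  under eq_bigr do rewrite mulr_sumr mulr_suml.
  rewrite exchange_big /=; apply: eq_bigr => m _.
  under [LHS]eq_bigr do rewrite mulrACA -mulrA.
  rewrite -mulr_sumr; congr (_ * _).
  under eq_bigr do rewrite /sbm_cond /null_pmf -prodfV -!big_split /=.
  rewrite -(bigA_distr_bigA (fun (e : edge n) b =>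
    bernoulli_pmf (rho * signal eps x (l (val e).1) (l (val e).2)) b *
    bernoulli_pmf (rho * signal eps x (m (val e).1) (m (val e).2)) b /
    bernoulli_pmf q b)) /=.
  apply: eq_bigr => e _; rewrite /signal !mulrA -/q bernoulli_chi2 //.
  by congr (1 + _); ring.
- by move=> a; exact: le_linear_quadratic.
Qed.

(** * Two-block signal: the rate rho / n *)

Definition ffun_cons (T : Type) n (t : T) (l : {ffun 'I_n -> T}) :
    {ffun 'I_n.+1 -> T} :=
  [ffun i => if unlift ord0 i is Some j then l j else t].

Lemma sum_ffun_cons (V : nmodType) (T : finType) n
    (F : {ffun 'I_n.+1 -> T} -> V) :
  \sum_l F l = \sum_t \sum_l F (ffun_cons t l).
Proof.
rewrite pair_bigA /=
  (reindex (fun u : T * {ffun 'I_n -> T} => ffun_cons u.1 u.2)) //.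
exists (fun l : {ffun 'I_n.+1 -> T} =>
  (l ord0, [ffun j : 'I_n => l (lift ord0 j)])) => [[t l] _ /=|l _ /=].
  congr (_, _); first by rewrite ffunE unlift_none.
  by apply/ffunP => j; rewrite !ffunE liftK.
by apply/ffunP => i; rewrite ffunE; case: unliftP => [j ->|->]; rewrite ?ffunE.
Qed.

Definition rad_sum (R : realType) n (z : {ffun 'I_n -> bool}) : R :=
  \sum_i (-1) ^+ z i.

Lemma rad_sum_cons (R : realType) n b (z : {ffun 'I_n -> bool}) :
  rad_sum R (ffun_cons b z) = (-1) ^+ b + rad_sum R z.
Proof.
rewrite /rad_sum big_ord_recl ffunE unlift_none; congr (_ + _).
by apply: eq_bigr => i _; rewrite ffunE liftK.
Qed.

Lemma rad_sum_le (R : realType) n (z : {ffun 'I_n -> bool}) :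
  `|rad_sum R z| <= n%:R.
Proof.
apply: le_trans (ler_norm_sum _ _ _) _.
by under eq_bigr do rewrite normr_sign; rewrite sumr_const card_ord.
Qed.

Lemma expR_le_inv (R : realType) (x : R) : x < 1 -> expR x <= (1 - x)^-1.
Proof.
move=> x1; rewrite -[expR x]invrK -expRN lef_pV2 ?posrE ?expR_gt0 ?subr_gt0 //.
by have := expR_ge1Dx (- x).
Qed.

(** Averaging [expR y <= (1 - y)^-1] and its mirror image gives 1 / (1 - y^2), which is at most 1 +
    2 y^2 in this range. *)
Lemma cosh_le (R : realType) (y : R) : `|y| <= 2^-1 ->
  2^-1 * (expR y + expR (- y)) <= expR (2 * y ^+ 2).
Proof.
rewrite ler_norml => /andP[y1 y2].
have y2' : y ^+ 2 <= 4^-1.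
  rewrite -subr_ge0 (_ : _ - _ = (2^-1 - y) * (2^-1 + y)); last by field.
  by rewrite mulr_ge0 //; lra.
apply: (@le_trans _ _ (1 + 2 * y ^+ 2)); last exact: expR_ge1Dx.
apply: (@le_trans _ _ (2^-1 * ((1 - y)^-1 + (1 - (- y))^-1))).
  by rewrite ler_pM2l ?invr_gt0 // lerD // expR_le_inv //; lra.
rewrite (_ : 2^-1 * _ = (1 - y ^+ 2)^-1); last by field; apply/and3P; split; lra.
rewrite -div1r ler_pdivrMr; last by lra.
have := sqr_ge0 y; nra.
Qed.

(* Integrating out one sign changes [u] into [u + 4 u^2], i.e. [1 / u] into at
   least [1 / u - 4]. *)
Lemma rad_sum_mgf (R : realType) n (v : R) : 4 * n%:R < v ->
  \sum_(z : {ffun 'I_n -> bool}) expR (v^-1 * rad_sum R z ^+ 2 / 2)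
    <= 2 ^+ n * expR (n%:R / (2 * (v - 4 * n%:R))).
Proof.
elim: n v => [|n IHn] v vn.
  rewrite (eq_bigr (fun=> 1)) => [|z _]; last first.
    by rewrite /rad_sum big_ord0 expr0n /= mulr0 mul0r expR0.
  by rewrite sumr_const card_ffun card_ord expn0 mul0r expR0 mul1r.
have n0 : 0 <= n%:R :> R by [].
have nS : n.+1%:R = n%:R + 1 :> R by rewrite natr1.
rewrite nS in vn *.
have v0 : 0 < v by lra.
rewrite sum_ffun_cons big_bool /= -big_split /=.
apply: (@le_trans _ _ (\sum_(z : {ffun 'I_n -> bool})
    2 * expR (v^-1 / 2) * expR ((v - 4)^-1 * rad_sum R z ^+ 2 / 2))).
  apply: ler_sum => z _; rewrite !rad_sum_cons expr1 expr0.
  set S := rad_sum R z.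
  (* Only the cross term depends on the new sign; summing over this sign produces twice a hyperbolic
     cosine. *)
  have -> : v^-1 * (-1 + S) ^+ 2 / 2 =
     v^-1 / 2 + v^-1 * S ^+ 2 / 2 + - (v^-1 * S) by field; lra.
  have -> : v^-1 * (1 + S) ^+ 2 / 2 =
     v^-1 / 2 + v^-1 * S ^+ 2 / 2 + v^-1 * S by field; lra.
  set E1 := v^-1 * S ^+ 2 / 2; set E2 := (v - 4)^-1 * S ^+ 2 / 2.
  set y := v^-1 * S.
  rewrite !expRD -mulrDr -!mulrA [leRHS]mulrCA ler_pM2l ?expR_gt0 //.
  rewrite [_ + expR _]addrC.
  apply: (@le_trans _ _ (expR E1 * (2 * expR (2 * y ^+ 2)))).
    rewrite ler_pM2l ?expR_gt0 // -ler_pdivrMl //; apply: cosh_le.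
    rewrite normrM gtr0_norm ?invr_gt0 // ler_pdivrMl //.
    by apply: le_trans (rad_sum_le _ _) _; lra.
  rewrite [leLHS]mulrCA ler_pM2l // -expRD ler_expR.
  (* The product of 1/v + 4/v^2 and v - 4 is 1 - (4/v)^2 <= 1, so the new coefficient is at most 1 /
     (v - 4). *)
  have -> : E1 + 2 * y ^+ 2 = (v^-1 + 4 * v^-1 ^+ 2) * (S ^+ 2 / 2).
    by rewrite /E1 /y; field; lra.
  rewrite /E2 -mulrA ler_wpM2r ?divr_ge0 ?sqr_ge0 //.
  rewrite -[(v - 4)^-1]div1r ler_pdivlMr; last by lra.
  rewrite (_ : _ * _ = 1 - (4 / v) ^+ 2); last by field; lra.
  by rewrite lerBlDr lerDl sqr_ge0.
rewrite -mulr_sumr.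
have vn' : 4 * n%:R < v - 4 by lra.
apply: le_trans (ler_wpM2l _ (IHn _ vn')) _.
  by rewrite mulr_ge0 // expR_ge0.
rewrite mulrACA -exprS ler_pM2l ?exprn_gt0 // -expRD ler_expR.
set d := v - 4 - 4 * n%:R.
have d0 : 0 < d by rewrite /d; lra.
have -> : v - 4 * (n%:R + 1) = d by rewrite /d; ring.
rewrite (_ : (n%:R + 1) / _ = d^-1 / 2 + n%:R / (2 * d)); last by field; lra.
rewrite lerD2r ler_pM2r ?invr_gt0 // lef_pV2 ?posrE //.
by rewrite /d; lra.
Qed.

Lemma sum_edge (V : nmodType) n (F : 'I_n * 'I_n -> V) :
  \sum_(e : edge n) F (val e) = \sum_(u : 'I_n * 'I_n | (u.2 < u.1)%N) F u.
Proof.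
rewrite [RHS](reindex_omap (val : edge n -> _) insub) => [|u Pu]; last first.
  by rewrite insubT.
apply: eq_bigl => e; rewrite (valP e) /=; apply/esym/eqP.
by rewrite valK.
Qed.

(** After [1 + x <= expR x], the exponent sums the sign products over pairs below the diagonal. The
    square of [rad_sum] contains this sum twice, plus a nonnegative diagonal. *)
Lemma prod_edge_le (R : realType) n (u : R) (z : {ffun 'I_n -> bool}) :
  0 <= u <= 1 ->
  \prod_(e : edge n) (1 + u * ((-1) ^+ z (val e).1 * (-1) ^+ z (val e).2))
    <= expR (u * rad_sum R z ^+ 2 / 2).
Proof.
move=> /andP[u0 u1]; pose s i : R := (-1) ^+ z i.
apply: (@le_trans _ _ (\prod_(e : edge n)
    expR (u * (s (val e).1 * s (val e).2)))).
  apply: ler_prod => e _; rewrite expR_ge1Dx andbT.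
  by case: (z _); case: (z _); rewrite ?expr1 ?expr0; lra.
rewrite -expR_sum ler_expR -mulr_sumr -mulrA ler_wpM2l //.
rewrite (sum_edge (fun v => s v.1 * s v.2)) ler_pdivlMr // mulr_natr mulr2n.
have -> : rad_sum R z ^+ 2 = \sum_(v : 'I_n * 'I_n) s v.1 * s v.2.
  by rewrite expr2 big_distrlr pair_bigA.
rewrite [leRHS](bigID (fun v : 'I_n * 'I_n => (v.2 < v.1)%N)) /= lerD2l.
rewrite [leRHS](bigID (fun v : 'I_n * 'I_n => (v.1 < v.2)%N)) /=.
rewrite -[leLHS]addr0 lerD //.
  pose h (v : 'I_n * 'I_n) := (v.2, v.1).
  rewrite [leLHS](reindex_inj (_ : injective h)) /=;
    last by move=> [? ?] [? ?] [-> ->].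
  rewrite le_eqVlt; apply/orP; left; apply/eqP.
  apply: eq_big => [v|v _]; last by rewrite mulrC.
  by case: ltngtP.
apply: sumr_ge0 => -[i j] /=; rewrite -!leqNgt -eqn_leq => /eqP/val_inj->.
exact: sqr_ge0.
Qed.

(** For fixed [l], exclusive or with [l] is a bijection: the product of two independent uniform sign
    vectors is again uniform. *)
Lemma sum_labels_sign (R : realType) n (F : {ffun 'I_n -> bool} -> R) :
  \sum_(l : {ffun 'I_n -> bool}) \sum_(m : {ffun 'I_n -> bool})
    F [ffun i => l i (+) m i] = 2 ^+ n * \sum_z F z.
Proof.
transitivity (\sum_(l : {ffun 'I_n -> bool}) \sum_z F z).
  apply: eq_bigr => l _.
  pose h (m : {ffun 'I_n -> bool}) := [ffun i => l i (+) m i].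
  rewrite [RHS](reindex_inj (_ : injective h)) //.
  by apply: inv_inj => m; apply/ffunP => i; rewrite !ffunE addbA addbb.
by rewrite sumr_const card_ffun card_bool card_ord -natrX mulr_natl.
Qed.

Lemma minimax_two_block_signal (R : realType) (rho : R) (k n : nat) :
  0 < rho <= 1 -> (2 <= k <= n)%N ->
  ((640^-1 * Num.min (rho / n%:R) (rho ^+ 2))%:E <= minimax_risk n k rho)%E.
Proof.
move=> rho01 /andP[k2 kn]; have /andP[rho0 rho1] := rho01.
have n0 : 0 < n%:R :> R by rewrite ltr0n (leq_trans _ kn) // (leq_trans _ k2).
(* The square of [eps]. The first bound makes [u] at most 1 / (8n), the value used in [rad_sum_mgf];
   the second keeps the signal between 0 and 1. *)
pose e2 := Num.min ((8 * rho * n%:R)^-1) 1.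
have e20 : 0 < e2 by rewrite /e2 lt_min ltr01 andbT invr_gt0 !mulr_gt0.
have e21 : e2 <= 1 by rewrite /e2 ge_min lexx orbT.
have e2n : rho * e2 <= (8 * n%:R)^-1.
  apply: (@le_trans _ _ (rho * (8 * rho * n%:R)^-1)).
    by rewrite ler_wpM2l ?(ltW rho0) // /e2 ge_min lexx.
  by rewrite le_eqVlt; apply/orP; left; apply/eqP; field; rewrite !gt_eqF.
pose eps := Num.sqrt e2.
have epsE : eps ^+ 2 = e2 by rewrite sqr_sqrtr ?ltW.
have eps0 : 0 <= eps by exact: sqrtr_ge0.
have eps1 : eps <= 1 by rewrite -sqrtr1 ler_wsqrtr.
pose x (th : bool) (s t : bool) : R := if th then (-1) ^+ s * (-1) ^+ t else 0.
have x1 th s t : -1 <= x th s t <= 1.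
  by case: th; case: s; case: t; rewrite /x /= ?expr0 ?expr1; lra.
pose p (_ _ : bool) : R := 2^-1.
pose u := rho / 2 / (1 - rho / 2) * eps ^+ 2.
have u0 : 0 <= u.
  by rewrite mulr_ge0 ?sqr_ge0 // divr_ge0 //; lra.
have un : u <= (8 * n%:R)^-1.
  apply: le_trans e2n; rewrite /u epsE ler_wpM2r ?(ltW e20) //.
  by rewrite ler_pdivrMr; [nra|lra].
have u1 : u <= 1.
  have n1 : 1 <= n%:R :> R by rewrite ler1n -(ltr0n R).
  by apply: le_trans un _; rewrite invf_le1; lra.
have p0 th t : 0 <= p th t by rewrite /p invr_ge0.
have p1 th : \sum_t p th t = 1 by rewrite big_bool /p /=; field.
(* With second moment at most expR (1/8) <= 8/7, the error mass is (8/7) / (4 * 3/4) = 8/21, and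
   8/21 + (3/4) / 2 < 4/5 leaves a failure probability of at least 1/5. *)
have c34 : 0 < 3 / 4 :> R by rewrite divr_gt0.
have /choice[g gP] th := @sbm_pmf_le_null R bool n (p th) rho eps (3 / 4)
  (x th) c34 rho01 (p0 th).
have gG th : \sum_a g th a <= 8 / 21.
  have [_ -> _] := gP th.
  rewrite (_ : 8 / 21 = (4 * (3 / 4))^-1 * (8 / 7)); last by field.
  rewrite ler_pM2l ?invr_gt0 ?mulr_gt0 // -/u.
  have lE b (l : {ffun 'I_n -> bool}) : label_pmf (p b) l = (2 ^+ n)^-1 :> R.
    by rewrite /label_pmf prodr_const card_ord exprVn.
  have two0 : 0 < 2 ^+ n :> R by rewrite exprn_gt0.
  case: th => /=; last first.
    rewrite (eq_bigr (fun l => label_pmf (p false) l)) => [|l _].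
      by rewrite label_pmf_sum1 //; lra.
    rewrite -[RHS]mulr1 -[in RHS](label_pmf_sum1 n (p1 false)) mulr_sumr.
    apply: eq_bigr => m _; rewrite big1 ?mulr1 // => e _.
    by rewrite mulr0 mulr0 addr0.
  pose F (z : {ffun 'I_n -> bool}) := \prod_(e : edge n)
    (1 + u * ((-1) ^+ z (val e).1 * (-1) ^+ z (val e).2)).
  apply: (@le_trans _ _ (\sum_(l : {ffun 'I_n -> bool})
     \sum_(m : {ffun 'I_n -> bool}) (2 ^+ n)^-1 * (2 ^+ n)^-1 *
     F [ffun i => l i (+) m i])).
    apply: ler_sum => l _; apply: ler_sum => m _.
    rewrite !lE le_eqVlt; apply/orP; left; apply/eqP; congr (_ * _).
    apply: eq_bigr => e _; rewrite !ffunE !signr_addb /x.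
    by congr (1 + u * _); rewrite mulrACA.
  rewrite (eq_bigr (fun l : {ffun 'I_n -> bool} => (2 ^+ n)^-1 * (2 ^+ n)^-1 *
    \sum_(m : {ffun 'I_n -> bool}) F [ffun i => l i (+) m i])); last first.
    by move=> l _; rewrite mulr_sumr.
  rewrite -mulr_sumr (sum_labels_sign F) mulrA mulfVK ?gt_eqF //.
  rewrite ler_pdivrMl //.
  have v0 : 4 * n%:R < 8 * n%:R :> R by lra.
  have := rad_sum_mgf v0.
  rewrite (_ : n%:R / _ = 8^-1); last first.
    by rewrite -mulrBl; field; rewrite gt_eqF.
  move=> B; apply: (@le_trans _ _ (2 ^+ n * expR 8^-1)); last first.
    rewrite ler_pM2l //; apply: le_trans (expR_le_inv _) _; first by lra.
    by rewrite le_eqVlt; apply/orP; left; apply/eqP; field.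
  apply: le_trans B; apply: ler_sum => z _.
  apply: le_trans (prod_edge_le _ _) _; first by rewrite u0.
  by rewrite ler_expR ler_pM2r ?invr_gt0 // ler_wpM2r ?sqr_ge0.
have Q01 th s t : 0 <= signal eps (x th) s t <= 1.
  have := x1 th s t; rewrite /signal; nra.
have Qsym th s t : signal eps (x th) s t = signal eps (x th) t s.
  by rewrite /signal /x; case: th => //; rewrite [_ ^+ s * _]mulrC.
have q01 : 0 < rho / 2 < 1 by lra.
(* The two signals differ by [eps / 2] at all labels, so every coupling has loss exactly
   [e2 / 4 = 4 * r / rho ^+ 2]. *)
pose r := rho ^+ 2 * e2 / 16.
have r0 : 0 <= r by rewrite /r divr_ge0 // mulr_ge0 ?sqr_ge0 // ltW.
have xdist th th0 s t s' t' : th <> th0 ->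
    (signal eps (x th) s t - signal eps (x th0) s' t') ^+ 2 = e2 / 4.
  rewrite /signal -epsE /x.
  by case: th => //=; case: th0 => //=; case: s; case: t; case: s'; case: t';
    rewrite ?expr0 ?expr1 => _ //; field.
have closeL th0 : (#|[pred th | `[< sbm_close (p th) (p th0)
    (signal eps (x th)) (signal eps (x th0)) (4 * r / rho ^+ 2) >]]|%:R <= (1 : R)).
  rewrite lern1; apply: (@leq_trans #|pred1 th0|); last by rewrite card1.
  apply: subset_leq_card; apply/fintype.subsetP => th.
  rewrite !inE => -[w [[w0 w1 w2] lossw]].
  apply/eqP; apply: contrapT => thth0; move: lossw.
  have sw : \sum_(v : bool * bool) w v.1 v.2 = 1.
    by rewrite -(pair_bigA _ w) /= -(p1 th); apply: eq_bigr => s _; rewrite w1.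
  apply/negP; rewrite -leNgt /coupling_loss.
  rewrite (eq_bigr (fun v : bool * bool => w v.1 v.2 * (e2 / 4))); last first.
    move=> v _; rewrite [in RHS](_ : e2 / 4 =
      \sum_(v : bool * bool) w v.1 v.2 * (e2 / 4)); last first.
      by rewrite -mulr_suml sw mul1r.
    rewrite mulr_sumr.
    apply: eq_bigr => v' _; rewrite [RHS]mulrA; congr (_ * _).
    exact: xdist.
  rewrite -mulr_suml sw mul1r /r le_eqVlt; apply/orP; left; apply/eqP.
  by field; rewrite gt_eqF.
have := @minimax_list_bound R bool bool p (fun th => signal eps (x th)) rho r
  (3 / 4) (8 / 21) 1 k n (null_pmf (rho / 2)) g.
rewrite card_bool => /(_ isT k2 rho01 r0 (ltW c34) p0 p1 Qsym Q01
  (fun a => ltW (null_pmf_gt0 a q01)) (null_pmf_sum1 _ _)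
  (fun th => let: And3 h _ _ := gP th in h) gG
  (fun th => let: And3 _ _ h := gP th in h) closeL).
apply: le_trans; rewrite lee_fin.
apply: (@le_trans _ _ (r * 5^-1)); last by rewrite ler_wpM2l //; lra.
rewrite /r.
have : Num.min (rho / n%:R) (rho ^+ 2) <= 8 * (rho ^+ 2 * e2).
  rewrite /e2 minr_pMr ?sqr_ge0 // minr_pMr // mulr1.
  have -> : 8 * (rho ^+ 2 / (8 * rho * n%:R)) = rho / n%:R.
    by field; rewrite !gt_eqF.
  rewrite le_min !ge_min lexx /= orbC.
  by rewrite ler_peMl ?sqr_ge0 //; lra.
by lra.
Qed.

(** * Rounding couplings to maps *)

(** The law of a random map whose values [pi a] are independent, each drawn from the row [u a]. *)
Definition round_prob (R : realType) (T : finType) (u : T -> T -> R)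
    (pi : {ffun T -> T}) : R := \prod_a u a (pi a).

Lemma round_prob_expect (R : realType) (T : finType) (u f : T -> T -> R) :
  \sum_pi round_prob u pi * \prod_a f a (pi a) =
  \prod_a \sum_c u a c * f a c.
Proof.
rewrite (bigA_distr_bigA (fun a c => u a c * f a c)) /=.
by apply: eq_bigr => pi _; rewrite -big_split.
Qed.

Lemma round_prob_marginal1 (R : realType) (T : finType) (u : T -> T -> R)
    (a : T) (f : T -> R) :
  (forall s, \sum_t u s t = 1) ->
  \sum_pi round_prob u pi * f (pi a) = \sum_c u a c * f c.
Proof.
move=> u1.
transitivity (\prod_i \sum_c u i c * (if i == a then f c else 1)).
  rewrite -round_prob_expect; apply: eq_bigr => pi _; congr (_ * _).
  by rewrite (bigD1 a) //= eqxx big1 ?mulr1 // => i /negbTE ->.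
rewrite (bigD1 a) //= [X in _ * X]big1 ?mulr1 => [|i /negbTE ia].
  by apply: eq_bigr => c _; rewrite eqxx.
by rewrite -[RHS](u1 i); apply: eq_bigr => c _; rewrite ia mulr1.
Qed.

Lemma round_prob_marginal2 (R : realType) (T : finType) (u : T -> T -> R)
    (a b : T) (h : T -> T -> R) :
  (forall s, \sum_t u s t = 1) -> a != b ->
  \sum_pi round_prob u pi * h (pi a) (pi b) =
  \sum_c \sum_d u a c * u b d * h c d.
Proof.
move=> u1 ab; have ba : b != a by rewrite eq_sym.
have E c d : \sum_pi round_prob u pi * ((pi a == c)%:R * (pi b == d)%:R) =
    u a c * u b d.
  transitivity (\prod_i \sum_e u i e *
      (if i == a then (e == c)%:R else if i == b then (e == d)%:R else 1)).
    rewrite -round_prob_expect; apply: eq_bigr => pi _; congr (_ * _).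
    rewrite (bigD1 a) //= eqxx (bigD1 b) //= (negbTE ba) eqxx.
    by rewrite big1 ?mulr1 // => i /andP[/negbTE -> /negbTE ->].
  rewrite (bigD1 a) //= [X in _ * X](bigD1 b) //= 
    [X in _ * (_ * X)]big1 ?mulr1; last first.
    move=> i /andP[/negbTE ia /negbTE ib].
    by rewrite -[RHS](u1 i); apply: eq_bigr => e _; rewrite ia ib mulr1.
  congr (_ * _).
    rewrite (bigD1 c) //= !eqxx mulr1 big1 ?addr0 // => e /negbTE ->.
    by rewrite mulr0.
  rewrite (bigD1 d) //= (negbTE ba) !eqxx mulr1 big1 ?addr0 // => e /negbTE ->.
  by rewrite mulr0.
under [RHS]eq_bigr do under eq_bigr do rewrite -E mulr_suml.
under [RHS]eq_bigr do rewrite exchange_big.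
rewrite exchange_big /=; apply: eq_bigr => pi _.
rewrite (bigD1 (pi a)) //= (bigD1 (pi b)) //= !eqxx !mulr1.
rewrite [X in _ + X]big1 => [|c /negbTE]; last first.
  by rewrite eq_sym => e; rewrite big1 // => d _; rewrite e ?(mulr0, mul0r).
rewrite addr0 big1 ?addr0 // => d /negbTE; rewrite eq_sym => ->.
by rewrite ?(mulr0, mul0r).
Qed.

(** Take the expectation of the inequality over a random [pi]. The right side is restricted to
    distinct points, where the two values of [pi] are independent. *)
Lemma rounding (R : realType) (T : finType) (u : T -> T -> R)
    (h : T -> T -> T -> T -> R) (g : T -> T -> R) :
  (forall s t, 0 <= u s t) -> (forall s, \sum_t u s t = 1) ->
  (forall pi : {ffun T -> T},
    \sum_a g a (pi a) <=
    \sum_(v : T * T | v.1 != v.2) h v.1 v.2 (pi v.1) (pi v.2)) ->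
  \sum_a \sum_c u a c * g a c <=
  \sum_(v : T * T | v.1 != v.2)
    \sum_c \sum_d u v.1 c * u v.2 d * h v.1 v.2 c d.
Proof.
move=> u0 u1 gh.
rewrite (eq_bigr (fun a => \sum_pi round_prob u pi * g a (pi a))); last first.
  by move=> a _; rewrite (round_prob_marginal1 a (g a) u1).
rewrite [leRHS](eq_bigr (fun v : T * T =>
    \sum_pi round_prob u pi * h v.1 v.2 (pi v.1) (pi v.2))); last first.
  by move=> v ab; rewrite (round_prob_marginal2 (h v.1 v.2) u1 ab).
rewrite exchange_big [leRHS]exchange_big /=; apply: ler_sum => pi _.
by rewrite -!mulr_sumr ler_wpM2l // prodr_ge0.
Qed.

(* Rounding each row of the coupling independently to a random map [pi] turns
   a bound valid for maps into one valid for couplings. *)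
Lemma coupling_rounding (R : realType) (T : finType) (p1 p2 : T -> R)
    (Q1 Q2 : T -> T -> R) (w g : T -> T -> R) (m : R) :
  coupling p1 p2 w -> 0 < m -> (forall s, m <= p1 s) ->
  (forall pi : {ffun T -> T}, \sum_a g a (pi a) <=
     \sum_(v : T * T | v.1 != v.2) (Q1 v.1 v.2 - Q2 (pi v.1) (pi v.2)) ^+ 2) ->
  m ^+ 2 * \sum_a \sum_c w a c / p1 a * g a c <= coupling_loss Q1 Q2 w.
Proof.
move=> [w0 w1 _] m0 mp gQ.
have p0 s : 0 < p1 s := lt_le_trans m0 (mp s).
have u0 s t : 0 <= w s t / p1 s by rewrite divr_ge0 // ltW.
have u1 s : \sum_t w s t / p1 s = 1 by rewrite -mulr_suml w1 divff ?gt_eqF.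
have /= H := rounding (h := fun a b c d => (Q1 a b - Q2 c d) ^+ 2) u0 u1 gQ.
apply: le_trans (ler_wpM2l (sqr_ge0 m) H) _.
rewrite mulr_sumr.
have -> : coupling_loss Q1 Q2 w = \sum_(v : T * T) \sum_c \sum_d
    w v.1 c * w v.2 d * (Q1 v.1 v.2 - Q2 c d) ^+ 2.
  rewrite /coupling_loss -(pair_bigA _ (fun a c => \sum_(v : T * T)
    w a c * w v.1 v.2 * (Q1 a v.1 - Q2 c v.2) ^+ 2)) /=.
  rewrite -(pair_bigA _ (fun a b => \sum_c \sum_d
    w a c * w b d * (Q1 a b - Q2 c d) ^+ 2)) /=.
  apply: eq_bigr => a _; rewrite [RHS]exchange_big /=; apply: eq_bigr => c _.
  by rewrite -(pair_bigA _ (fun b d => w a c * w b d * (Q1 a b - Q2 c d) ^+ 2)).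
(* The diagonal terms are nonnegative and are dropped; off the diagonal, [m <= p1] lets [m ^+ 2]
   absorb the normalization of the two rows. *)
rewrite [leRHS](bigID (fun v : T * T => v.1 != v.2)) /= -[leLHS]addr0 lerD //.
  apply: ler_sum => v _; rewrite mulr_sumr; apply: ler_sum => c _.
  rewrite mulr_sumr; apply: ler_sum => d _; rewrite [leLHS]mulrA.
  rewrite ler_wpM2r ?sqr_ge0 //.
  rewrite [leLHS](_ : _ =
      (w v.1 c * w v.2 d) * ((m / p1 v.1) * (m / p1 v.2))); last first.
    by field; rewrite !gt_eqF.
  rewrite ler_piMr ?mulr_ge0 // mulr_ile1 ?divr_ge0 ?(ltW m0) ?(ltW (p0 _)) //;
    by rewrite ler_pdivrMr // mul1r.
apply: sumr_ge0 => v _; apply: sumr_ge0 => c _; apply: sumr_ge0 => d _.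
by rewrite mulr_ge0 ?sqr_ge0 // mulr_ge0.
Qed.

(** * Counting by disagreement *)

Definition disagreement (E : finType) (A : pred E) (x y : E -> bool) : nat :=
  #|[pred e | (e \in A) && (x e != y e)]|.

Lemma disagreementE (R : realType) (E : finType) (A : pred E) (x y : E -> bool) :
  4^-1 ^+ disagreement A x y =
  \prod_e (if (e \in A) && (x e != y e) then 4^-1 else 1) :> R.
Proof. by rewrite -big_mkcond /= prodr_const; congr (_ ^+ _); apply: eq_card. Qed.

(* Generating function at [z = 1 / 4]. The involution flipping [x] on [A] by
   [y x] turns the disagreement of [x] and [y x] into the weight of [x] on [A]. *)
Lemma disagreement_gf (R : realType) (E : finType) (A : pred E)
    (y : {ffun E -> bool} -> E -> bool) :
  (forall x x' : {ffun E -> bool}, (forall e, e \notin A -> x e = x' e) ->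
    forall e, e \in A -> y x e = y x' e) ->
  \sum_(x : {ffun E -> bool}) 4^-1 ^+ disagreement A x (y x) =
    2 ^+ #|E| * (5 / 8) ^+ #|A| :> R.
Proof.
move=> yA.
pose h (x : {ffun E -> bool}) : {ffun E -> bool} :=
  [ffun e => if e \in A then x e (+) y x e else x e].
have yh x e : e \in A -> y (h x) e = y x e.
  by apply: yA => e' /negbTE Ae'; rewrite ffunE Ae'.
have hK : involutive h.
  move=> x; apply/ffunP => e; rewrite ffunE.
  case: ifP => eA; last by rewrite ffunE eA.
  by rewrite yh // ffunE eA -addbA addbb addbF.
rewrite (reindex_inj (inv_inj hK)) /=.
transitivity (\sum_(x : {ffun E -> bool})
    \prod_e (if (e \in A) && x e then 4^-1 else 1 : R)).
  apply: eq_bigr => x _; rewrite disagreementE; apply: eq_bigr => e _.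
  case eA: (e \in A) => //=; rewrite yh // ffunE eA.
  by case: (x e); case: (y x e).
(* Entries in [A] contribute 1 + 1/4 = 2 * (5/8), the others 2. *)
rewrite -(bigA_distr_bigA (fun e b => if (e \in A) && b then 4^-1 else 1 : R)) /=.
rewrite (eq_bigr (fun e => 2 * (if e \in A then 5 / 8 else 1))).
  by rewrite big_split prodr_const /= -big_mkcond prodr_const.
move=> e _; rewrite big_bool andbT andbF; case: (e \in A) => /=;
  last by rewrite mulr1.
by field.
Qed.

(** Markov's inequality for the generating function. The target [y x] may depend on [x], but on [A]
    only through the entries outside [A]. *)
Lemma disagreement_count (R : realType) (E : finType) (A : pred E)
    (y : {ffun E -> bool} -> E -> bool) (t : nat) :
  (forall x x' : {ffun E -> bool}, (forall e, e \notin A -> x e = x' e) ->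
    forall e, e \in A -> y x e = y x' e) ->
  (8 * t <= #|A|)%N ->
  #|[pred x : {ffun E -> bool} | (disagreement A x (y x) <= t)%N]|%:R
    <= 2 ^+ #|E| * (3 / 4) ^+ #|A| :> R.
Proof.
move=> yA tA.
have H : #|[pred x : {ffun E -> bool} | (disagreement A x (y x) <= t)%N]|%:R *
    4^-1 ^+ t <= 2 ^+ #|E| * (5 / 8) ^+ #|A| :> R.
  rewrite -(disagreement_gf R yA) mulr_natl -sumr_const big_mkcond /=.
  apply: ler_sum => x _; case: ifP => [|_]; last by rewrite exprn_ge0 ?invr_ge0.
  by rewrite !inE => xt; rewrite ler_wiXn2l ?invr_ge0 ?invf_le1 //; lra.
have t0 : 0 < 4^-1 ^+ t :> R by rewrite exprn_gt0 ?invr_gt0.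
rewrite -(ler_pM2r t0); apply: le_trans H _.
rewrite -mulrA ler_pM2l ?exprn_gt0 //.
rewrite (_ : 5 / 8 = 3 / 4 * (5 / 6)); last by field.
rewrite exprMn ler_pM2l ?exprn_gt0 ?divr_gt0 //.
(* The factor lost to Markov is absorbed because (5/6)^8 <= 1/4. *)
apply: (@le_trans _ _ ((5 / 6) ^+ (8 * t))).
  by rewrite ler_wiXn2l ?divr_ge0 //; lra.
by rewrite exprM lerXn2r ?nnegrE ?exprn_ge0 ?invr_ge0 ?divr_ge0 //; lra.
Qed.

(** * Exponential decay against polynomial factors *)

Definition rate (R : realType) : R := - ln (3 / 4) / 8.

Lemma rate_gt0 (R : realType) : 0 < rate R.
Proof. by rewrite divr_gt0 // oppr_gt0 ln_lt0 //; lra. Qed.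

Lemma rateE (R : realType) n : (3 / 4) ^+ n = expR (- (8 * rate R * n%:R)).
Proof.
rewrite (_ : - _ = n%:R * ln (3 / 4)); last by rewrite /rate; field.
by rewrite expRM_natl lnK // posrE divr_gt0.
Qed.

Lemma expR_ge_poly4 (R : realType) (x : R) : 0 <= x -> (x / 4) ^+ 4 <= expR x.
Proof.
move=> x0; have -> : expR x = expR (x / 4) ^+ 4.
  by rewrite -expRM_natl; congr expR; field.
rewrite lerXn2r ?nnegrE ?expR_ge0 ?divr_ge0 //.
by apply: le_trans (expR_ge1Dx _); rewrite lerDr.
Qed.

Lemma exp_small (R : realType) (b : R) : 0 < b ->
  exists k0, forall k, (k0 <= k)%N ->
    k%:R ^+ 2 * expR (- (b * k%:R)) <= 4^-1.
Proof.
(* [C] turns (1/4) (b k / 4)^4 into k^2 (k^2 / C), which is at least k^2 once [C <= k]. *)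
move=> b0; pose C := 4 * (4 / b) ^+ 4.
have C0 : 0 <= C by rewrite mulr_ge0 ?exprn_ge0 ?divr_ge0 // ltW.
exists (Num.trunc C).+1 => k kC.
have Ck : C <= k%:R.
  by apply: ltW; apply: lt_le_trans (truncnS_gt C) _; rewrite ler_nat.
have k1 : 1 <= k%:R :> R by rewrite ler1n (leq_trans _ kC).
rewrite expRN ler_pdivrMr ?expR_gt0 //.
apply: (@le_trans _ _ (4^-1 * (b * k%:R / 4) ^+ 4)); last first.
  by rewrite ler_pM2l ?invr_gt0 // expR_ge_poly4 // mulr_ge0 // ltW.
have -> : 4^-1 * (b * k%:R / 4) ^+ 4 = k%:R ^+ 2 * (k%:R ^+ 2 / C).
  by rewrite /C; field; rewrite gt_eqF.
have C1 : 0 < C by rewrite mulr_gt0 // exprn_gt0 // divr_gt0.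
rewrite ler_peMr ?sqr_ge0 // ler_pdivlMr // mul1r.
by apply: le_trans Ck _; rewrite expr2 ler_peMr //; lra.
Qed.

(** * Symmetric 0/1 matrices and unordered pairs *)

Definition upair (T : finType) (a b : T) : T * T :=
  if (enum_rank a < enum_rank b)%N then (a, b) else (b, a).

Definition upairs (T : finType) : pred (T * T) :=
  [pred u | (enum_rank u.1 < enum_rank u.2)%N].

(** Reading an arbitrary function at the ordered representative of a pair makes every point of a
    Boolean cube a symmetric matrix, so that [disagreement_count] applies to the whole cube. *)
Definition sym_fun (T : finType) (q : {ffun T * T -> bool}) a b := q (upair a b).

Lemma upairC (T : finType) (a b : T) : upair a b = upair b a.
Proof.
rewrite /upair; case: ltngtP => //= /val_inj/enum_rank_inj ->.
by [].
Qed.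

Lemma sym_funC (T : finType) q (a b : T) : sym_fun q a b = sym_fun q b a.
Proof. by rewrite /sym_fun upairC. Qed.

Lemma upairE (T : finType) (u : T * T) : u \in @upairs T -> upair u.1 u.2 = u.
Proof. by rewrite inE /upair => ->; case: u. Qed.

Lemma upairs_neq (T : finType) (u : T * T) : u \in @upairs T -> u.1 != u.2.
Proof. by rewrite inE; apply: contraTneq => ->; rewrite ltnn. Qed.

Lemma card_upairs (T : finType) : (2 * #|@upairs T| + #|T| = #|T| ^ 2)%N.
Proof.
pose h (u : T * T) := (u.2, u.1).
have hI : injective h by move=> [? ?] [? ?] [-> ->].
have dI : injective (fun a : T => (a, a)) by move=> ? ? [].
pose below : pred (T * T) := [pred u | (enum_rank u.2 < enum_rank u.1)%N].
pose diag : pred (T * T) := [pred u | u.1 == u.2].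
have E1 : #|below| = #|@upairs T|.
  rewrite -(fintype.card_image hI); apply: eq_card => u; rewrite !inE.
  apply/fintype.imageP/idP => [[v]|u21]; first by rewrite inE => v12 ->.
  by exists (h u); [rewrite inE|case: u {u21}].
have E2 : #|diag| = #|T|.
  rewrite -(fintype.card_image dI); apply: eq_card => -[a b]; rewrite !inE /=.
  apply/eqP/fintype.imageP => [->|[c _ [-> ->]]] //.
  by exists b.
have E3 : #|[predC @upairs T]| = (#|below| + #|diag|)%N.
  rewrite -(cardID below [predC @upairs T]); congr (_ + _)%N; apply: eq_card => u;
    rewrite !inE; first by case: ltngtP.
  apply/idP/eqP => [|->]; last by rewrite ltnn.
  by rewrite -!leqNgt -eqn_leq => /eqP/val_inj/enum_rank_inj.
have := cardC (@upairs T); rewrite E3 E1 E2 card_prod mulnn => <-.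
by rewrite mul2n -addnn addnA.
Qed.

Lemma disagreement_le_sum (R : realType) (T : finType) (A : pred (T * T))
    (q q0 : {ffun T * T -> bool}) (pi : {ffun T -> T}) :
  {subset A <= @upairs T} ->
  (disagreement A q (fun u => sym_fun q0 (pi u.1) (pi u.2)))%:R <=
  \sum_(v : T * T | v.1 != v.2)
     (sym_fun q v.1 v.2 != sym_fun q0 (pi v.1) (pi v.2))%:R :> R.
Proof.
move=> AU; rewrite /disagreement -sum1_card natr_sum big_mkcond [leRHS]big_mkcond.
apply: ler_sum => u _; rewrite !inE.
case: ifP => [/andP[uA qu]|_]; last by case: ifP.
by rewrite upairs_neq ?AU // /sym_fun upairE ?AU // qu.
Qed.

Lemma card_exists_le (T U : finType) (P : pred T) (B : U -> pred T) :
  (forall x, P x -> exists u, B u x) -> (#|P| <= \sum_u #|B u|)%N.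
Proof.
move=> PB; rewrite -sum1_card big_mkcond.
under [leqRHS]eq_bigr do rewrite -sum1_card big_mkcond.
rewrite exchange_big /=; apply: leq_sum => x _.
case: ifP => // /PB[u Bu]; rewrite (bigD1 u) //=.
by rewrite [u in (_ <= u + _)%N]ifT // ltn_addr.
Qed.

Lemma sqr_sign_diff (R : realType) (eps : R) (a b : bool) :
  (2^-1 * (1 + eps * (-1) ^+ a) - 2^-1 * (1 + eps * (-1) ^+ b)) ^+ 2 =
  eps ^+ 2 * (a != b)%:R.
Proof. by case: a; case: b; rewrite ?expr0 ?expr1 /=; field. Qed.

(** * Unknown connection matrix: the rate rho k^2 / n^2 *)

Lemma prod_edge_le_expR (R : realType) n (u : R) (y : edge n -> R) :
  0 <= u -> (forall e, -1 <= y e <= 1) -> u <= 1 ->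
  \prod_e (1 + u * y e) <= expR (u * n%:R ^+ 2).
Proof.
move=> u0 y1 u1; apply: (@le_trans _ _ (\prod_(e : edge n) expR u)).
  apply: ler_prod => e _; have /andP[? ?] := y1 e.
  apply/andP; split; first by nra.
  by apply: le_trans (expR_ge1Dx u); nra.
rewrite prodr_const -expRM_natr ler_expR ler_wpM2l // -natrX ler_nat.
apply: leq_trans (max_card _) _.
by rewrite card_sig (leq_trans (max_card _)) // card_prod card_ord mulnn.
Qed.

Lemma minimax_matrix (R : realType) : exists k0 (C : R), 0 < C /\
  forall (rho : R) (k n : nat), 0 < rho <= 1 -> (k0 <= k <= n)%N -> (2 <= k)%N ->
  ((C * Num.min (rho * (k%:R ^+ 2 / n%:R ^+ 2)) (rho ^+ 2))%:E
    <= minimax_risk n k rho)%E.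
Proof.
pose b := rate R; have b0 : 0 < b := rate_gt0 R.
have [k0 k0P] := exp_small b0.
exists k0, (256^-1 * Num.min b 1); split.
  by rewrite mulr_gt0 ?invr_gt0 // lt_min b0 ltr01.
move=> rho k n rho01 /andP[kk0 kn] k2; have /andP[rho0 rho1] := rho01.
have k00 : 0 < k%:R :> R by rewrite ltr0n (leq_trans _ k2).
have n0 : 0 < n%:R :> R by rewrite ltr0n (leq_trans _ kn) // (leq_trans _ k2).
(* The square of [eps], such that the second moment is at most [expR (b * k%:R ^+ 2)]. This large
   constant is affordable because the family is exponentially large in k^2. *)
pose e2 := Num.min (b * k%:R ^+ 2 / (rho * n%:R ^+ 2)) 1.
have e20 : 0 < e2.
  by rewrite /e2 lt_min ltr01 andbT divr_gt0 // mulr_gt0 // exprn_gt0.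
have e21 : e2 <= 1 by rewrite /e2 ge_min lexx orbT.
have e2n : rho * e2 * n%:R ^+ 2 <= b * k%:R ^+ 2.
  apply: (@le_trans _ _ (rho * (b * k%:R ^+ 2 / (rho * n%:R ^+ 2)) * n%:R ^+ 2)).
    rewrite ler_pM2r ?exprn_gt0 // ler_wpM2l ?(ltW rho0) //.
    by rewrite /e2 ge_min lexx.
  by rewrite le_eqVlt; apply/orP; left; apply/eqP; field; rewrite !gt_eqF.
pose eps := Num.sqrt e2.
have epsE : eps ^+ 2 = e2 by rewrite sqr_sqrtr ?ltW.
have eps0 : 0 <= eps by exact: sqrtr_ge0.
have eps1 : eps <= 1 by rewrite -sqrtr1 ler_wsqrtr.
pose T : finType := 'I_k.
pose Th : finType := {ffun T * T -> bool}.
pose x (th : Th) (s t : T) : R := (-1) ^+ sym_fun th s t.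
have x1 th s t : -1 <= x th s t <= 1.
  by rewrite /x; case: (sym_fun _ _ _); rewrite ?expr0 ?expr1; lra.
pose p (_ : Th) (_ : T) : R := k%:R^-1.
pose u := rho / 2 / (1 - rho / 2) * eps ^+ 2.
have u0 : 0 <= u.
  by rewrite mulr_ge0 ?sqr_ge0 // divr_ge0 //; lra.
have ue : u <= rho * e2.
  rewrite /u epsE ler_wpM2r ?(ltW e20) //.
  by rewrite ler_pdivrMr; [nra|lra].
have u1 : u <= 1 by nra.
have p0 th t : 0 <= p th t by rewrite /p invr_ge0.
have p1 th : \sum_t p th t = 1.
  by rewrite sumr_const card_ord -[LHS]mulr_natl divff ?gt_eqF.
pose B := expR (b * k%:R ^+ 2).
have B0 : 0 < B by exact: expR_gt0.
have /choice[g gP] th := @sbm_pmf_le_null R T n (p th) rho eps B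
  (x th) B0 rho01 (p0 th).
have gG th : \sum_a g th a <= 4^-1.
  have [_ -> _] := gP th; rewrite -/u.
  rewrite invfM -mulrA -[leRHS]mulr1 ler_pM2l ?invr_gt0 // ler_pdivrMl // mulr1.
  apply: (@le_trans _ _ (\sum_(l : {ffun 'I_n -> T}) \sum_(m : {ffun 'I_n -> T})
     label_pmf (p th) l * label_pmf (p th) m * B)).
    apply: ler_sum => l _; apply: ler_sum => m _.
    rewrite ler_wpM2l ?mulr_ge0 ?label_pmf_ge0 //.
    apply: le_trans (prod_edge_le_expR _ _ _) _ => // [e|].
      have := x1 th (l (val e).1) (l (val e).2).
      have := x1 th (m (val e).1) (m (val e).2).
      by rewrite /x; do 2 case: (sym_fun _ _ _); rewrite ?expr0 ?expr1 => _ _; lra.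
    by rewrite ler_expR (le_trans _ e2n) // ler_pM2r ?exprn_gt0.
  under eq_bigr do rewrite -mulr_suml -mulr_sumr label_pmf_sum1 // mulr1.
  by rewrite -mulr_suml label_pmf_sum1 // mul1r.
have Q01 th s t : 0 <= signal eps (x th) s t <= 1.
  by have := x1 th s t; rewrite /signal; nra.
have Qsym th s t : signal eps (x th) s t = signal eps (x th) t s.
  by rewrite /signal /x sym_funC.
have q01 : 0 < rho / 2 < 1 by lra.
pose A := @upairs T; pose t := (#|A| %/ 8)%N.
have tA : (8 * t <= #|A|)%N by rewrite mulnC leq_divM.
have AE : 2 * #|A|%:R + k%:R = k%:R ^+ 2 :> R.
  by rewrite -natrX -(card_ord k) -card_upairs natrD natrM card_ord.
have k2' : 2 <= k%:R :> R by rewrite (ler_nat _ 2).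
have Ak : k%:R ^+ 2 <= 4 * #|A|%:R :> R by nra.
have At : #|A|%:R <= 8 * t.+1%:R :> R.
  by rewrite -natrM ler_nat mulnC ltnW // ltn_ceil.
(* Here [4 * r / rho ^+ 2 = e2 * t.+1%:R / k%:R ^+ 2] is the loss forced by [coupling_rounding] with
   [m = k%:R^-1] if every map leaves more than [t] disagreements. *)
pose r := rho ^+ 2 * e2 * t.+1%:R / (4 * k%:R ^+ 2).
have r0 : 0 <= r.
  by rewrite /r !mulr_ge0 ?invr_ge0 ?mulr_ge0 ?sqr_ge0 // ltW.
pose L := #|{ffun T -> T}|%:R * (2 ^+ #|{: T * T}| * (3 / 4) ^+ #|A|) : R.
have closeL th0 : #|[pred th | `[< sbm_close (p th) (p th0)
    (signal eps (x th)) (signal eps (x th0)) (4 * r / rho ^+ 2) >]]|%:R <= L.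
  pose y (pi : {ffun T -> T}) (v : T * T) := sym_fun th0 (pi v.1) (pi v.2).
  pose ball (pi : {ffun T -> T}) : pred Th :=
    [pred th : Th | (disagreement A th (y pi) <= t)%N].
  apply: (@le_trans _ _ (\sum_(pi : {ffun T -> T}) #|ball pi|)%:R).
    rewrite ler_nat; apply: card_exists_le => th /asboolP[w [cw lossw]].
    apply: contrapT => /forallNP nball; move: lossw; apply/negP; rewrite -leNgt.
    have := @coupling_rounding R T _ _ (signal eps (x th)) (signal eps (x th0))
      w (fun _ _ => e2 * t.+1%:R / k%:R) k%:R^-1 cw _ (fun=> lexx _) _.
    rewrite invr_gt0 => /(_ k00) H; apply: le_trans (H _).
      under eq_bigr do rewrite -mulr_suml -mulr_suml.
      have [_ w1 _] := cw.
      under eq_bigr do rewrite w1 divff ?gt_eqF ?invr_gt0 // mul1r.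
      rewrite sumr_const card_ord /r le_eqVlt; apply/orP; left; apply/eqP.
      by rewrite -mulr_natl; field; rewrite !gt_eqF.
    move=> pi; rewrite sumr_const card_ord -[leLHS]mulr_natl.
    rewrite mulrCA divff ?gt_eqF // mulr1.
    under eq_bigr do rewrite /signal /x sqr_sign_diff epsE.
    rewrite -mulr_sumr ler_pM2l //.
    apply: le_trans (disagreement_le_sum _ th th0 pi (A := A) _) => //.
    by rewrite ler_nat ltnNge; apply/negP; exact: nball.
  rewrite natr_sum /L mulr_natl -sumr_const; apply: ler_sum => pi _.
  exact: (disagreement_count R (A := A) (y := fun=> y pi)).
have := @minimax_list_bound R Th T p (fun th => signal eps (x th)) rho r
  B 4^-1 L k n (null_pmf (rho / 2)) g.
have Th0 : (0 < #|Th|)%N by apply/card_gt0P; exists [ffun=> false].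
rewrite [#|T|]card_ord => /(_ Th0 (leqnn k) rho01 r0 (ltW B0) p0 p1 Qsym Q01
  (fun a => ltW (null_pmf_gt0 a q01)) (null_pmf_sum1 _ _)
  (fun th => let: And3 h _ _ := gP th in h) gG
  (fun th => let: And3 _ _ h := gP th in h) closeL).
apply: le_trans; rewrite lee_fin.
(* As [#|A|] is at least k^2 / 4, the factor (3/4)^[#|A|] is at most exp(-2bk^2): one half cancels
   [B], the other half pays for the k^k maps. *)
have LB : B * L / #|Th|%:R <= 4^-1.
  have -> : B * L / #|Th|%:R = B * k%:R ^+ k * (3 / 4) ^+ #|A|.
    rewrite /L !card_ffun card_bool !card_ord !natrX.
    by field; rewrite expf_neq0.
  rewrite /B rateE -/b.
  have kk : k%:R * expR (- (b * k%:R)) <= 4^-1.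
    apply: le_trans (k0P k kk0); rewrite ler_pM2r ?expR_gt0 //.
    by rewrite expr2 ler_peMr ?(ltW k00) //; lra.
  apply: (@le_trans _ _ ((k%:R * expR (- (b * k%:R))) ^+ k)).
    rewrite exprMn -[leLHS]mulrA [leLHS]mulrCA ler_pM2l ?exprn_gt0 //.
    by rewrite -expRD -expRM_natl ler_expR; nra.
  case: (k) kk k2 => // k' kk _; rewrite exprS -[leRHS]mulr1.
  rewrite ler_pM ?exprn_ge0 ?mulr_ge0 ?expR_ge0 // exprn_ile1 ?mulr_ge0 ?expR_ge0 //.
  by apply: le_trans kk _; lra.
apply: (@le_trans _ _ (r * 2^-1)); last by rewrite ler_wpM2l //; lra.
have re : rho ^+ 2 * e2 / 128 <= r.
  rewrite /r -[leRHS]mulrA ler_pM2l; last by rewrite mulr_gt0 ?exprn_gt0.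
  rewrite ler_pdivlMr ?mulr_gt0 ?exprn_gt0 //.
  by move: (k%:R ^+ 2) Ak At => K2; lra.
set X := rho * (_ / _); have X0 : 0 <= X.
  by rewrite /X mulr_ge0 ?divr_ge0 ?sqr_ge0 // ltW.
have m0 : 0 <= Num.min X (rho ^+ 2) by rewrite le_min X0 sqr_ge0.
suff H : Num.min b 1 * Num.min X (rho ^+ 2) <= rho ^+ 2 * e2 by lra.
have -> : rho ^+ 2 * e2 = Num.min (b * X) (rho ^+ 2).
  rewrite /e2 minr_pMr ?sqr_ge0 // mulr1; congr Num.min.
  by rewrite /X; field; rewrite !gt_eqF.
rewrite le_min; apply/andP; split.
  apply: (@le_trans _ _ (b * Num.min X (rho ^+ 2))).
    by rewrite ler_wpM2r // ge_min lexx.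
  by rewrite ler_pM2l // ge_min lexx.
apply: (@le_trans _ _ (1 * Num.min X (rho ^+ 2))).
  by rewrite ler_wpM2r // ge_min lexx orbT.
by rewrite mul1r ge_min lexx orbT.
Qed.

(** * Rigid 0/1 matrices *)

Definition moved (T : finType) (pi : T -> T) : pred T := [pred a | pi a != a].

Lemma prod_if_eq (R : comPzRingType) (T : finType) (x : T) (r : R) :
  \prod_i (if i == x then r else 1) = r.
Proof. by rewrite -big_mkcond /= big_pred1_eq. Qed.

(** [option bool] is a set of three colours; a uniform colouring is independent at three distinct
    points, hence the proportion 1/27. *)
Lemma coloring_count (R : realType) (T : finType) (x y z : T) :
  x != y -> x != z -> y != z ->
  \sum_(c : {ffun T -> option bool})
    [&& c x == Some true, c y == Some false & c z == None]%:R =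
  3 ^+ #|T| / 27 :> R.
Proof.
move=> xy xz yz.
pose F i (o : option bool) : R := (if i == x then (o == Some true)%:R else 1) *
  (if i == y then (o == Some false)%:R else 1) *
  (if i == z then (o == None)%:R else 1).
transitivity (\sum_(c : {ffun T -> option bool}) \prod_i F i (c i)).
  apply: eq_bigr => c _; rewrite /F !big_split /=.
  rewrite (eq_bigr (fun i => if i == x then (c x == Some true)%:R else 1)) =>
    [|i _]; last by case: eqP => // ->.
  rewrite [X in _ * X * _](eq_bigr
    (fun i => if i == y then (c y == Some false)%:R else 1)) =>
    [|i _]; last by case: eqP => // ->.
  rewrite [X in _ * _ * X](eq_bigr
    (fun i => if i == z then (c z == None)%:R else 1)) =>
    [|i _]; last by case: eqP => // ->.
  by rewrite !prod_if_eq -mulrA -!natrM !mulnb.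
rewrite -(bigA_distr_bigA F) /=.
have sum_option (G : option bool -> R) :
    \sum_o G o = G None + G (Some true) + G (Some false).
  rewrite (bigD1 None) // (bigD1 (Some true)) // (bigD1 (Some false)) //=.
  by rewrite big1 ?addr0 ?addrA // => -[[]|].
rewrite (eq_bigr (fun i => 3 * (if i == x then 3^-1 else 1) *
  (if i == y then 3^-1 else 1) * (if i == z then 3^-1 else 1))); last first.
  move=> i _; rewrite /F sum_option /=.
  have [->|ix] := eqVneq i x.
    by rewrite (negbTE xy) (negbTE xz) /=; field.
  have [->|iy] := eqVneq i y; first by rewrite (negbTE yz) /=; field.
  by have [_|iz] := eqVneq i z; rewrite /=; field.
rewrite !big_split /= !prod_if_eq prodr_const.
by field.
Qed.

Lemma averaging (R : realType) (C : finType) (f : C -> R) (v : R) :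
  (0 < #|C|)%N -> #|C|%:R * v <= \sum_c f c -> exists c, v <= f c.
Proof.
move=> C0 vf; apply: contrapT => /forallNP nf; move: vf; apply/negP.
rewrite -ltNge mulr_natl -sumr_const; have /card_gt0P[c1 _] := C0.
rewrite [ltLHS](bigD1 c1) // [ltRHS](bigD1 c1) //= ltr_leD ?ler_sum // => [|c _];
  [|apply: ltW]; rewrite ltNge; exact/negP/nf.
Qed.

(** First moment over a uniform colouring: each moved point [a] can be paired with any point other
    than [a] and [pi a], and each such choice succeeds with probability 1/27. *)
Lemma coloring_exists (R : realType) (T : finType) (pi : T -> T) :
  exists c : {ffun T -> option bool},
    #|moved pi|%:R * (#|T|%:R - 2) / 27 <= #|[pred v : T * T | [&& pi v.1 != v.1,
      c v.1 == Some true, c (pi v.1) == Some false & c v.2 == None]]|%:R :> R.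
Proof.
have C0 : (0 < #|{ffun T -> option bool}|)%N.
  by apply/card_gt0P; exists [ffun=> None].
apply: averaging => //.
rewrite card_ffun card_option card_bool natrX.
apply: (@le_trans _ _ (\sum_(v : T * T | pi v.1 != v.1)
  \sum_(c : {ffun T -> option bool}) [&& c v.1 == Some true,
    c (pi v.1) == Some false & c v.2 == None]%:R)); last first.
  rewrite exchange_big /=; apply: ler_sum => c _.
  rewrite -sum1_card natr_sum big_mkcond [leRHS]big_mkcond /=.
  apply: ler_sum => v _; rewrite inE.
  by case: (pi _ != _) => //=; case: ifP.
rewrite (eq_bigl (fun v : T * T => (pi v.1 != v.1) && predT v.2));
  last by move=> v; rewrite andbT.
rewrite -(pair_big (fun a => pi a != a) predT (fun a b =>
  \sum_(c : {ffun T -> option bool}) [&& c a == Some true,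
    c (pi a) == Some false & c b == None]%:R)) /=.
apply: (@le_trans _ _ (\sum_(a | pi a != a)
   (#|T|%:R - 2) * (3 ^+ #|T| / 27))).
  rewrite sumr_const -mulr_natl le_eqVlt; apply/orP; left; apply/eqP.
  by rewrite -/(moved pi); field.
apply: ler_sum => a pia.
rewrite (bigD1 a) //= (bigD1 (pi a)) //= addrA -[leLHS]add0r lerD //.
  by rewrite addr_ge0 // sumr_ge0.
rewrite (eq_bigr (fun=> 3 ^+ #|T| / 27)); last first.
  move=> b /andP[ba bpi]; apply: coloring_count; by rewrite eq_sym.
rewrite sumr_const -[leRHS]mulr_natl ler_wpM2r ?divr_ge0 ?exprn_ge0 //.
rewrite lerBlDr -natrD ler_nat.
rewrite -(cardC (pred2 a (pi a))) addnC leq_add //; last first.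
  by rewrite card2; case: (_ != _).
by apply: subset_leq_card; apply/fintype.subsetP => b; rewrite !inE negb_or.
Qed.

(* [A] consists of pairs joining a moved point [a] of the first colour to a
   point of the third one; as [pi a] has the second colour, [pi] maps no pair of
   [A] into [A]. *)
Lemma displaced_pairs (R : realType) (T : finType) (pi : T -> T) :
  exists A : pred (T * T), [/\ {subset A <= @upairs T},
    #|moved pi|%:R * (#|T|%:R - 2) / 27 <= #|A|%:R :> R
  & forall u, u \in A -> upair (pi u.1) (pi u.2) \notin A].
Proof.
have [c cP] := coloring_exists R pi.
pose S : pred (T * T) := [pred v : T * T | [&& pi v.1 != v.1,
      c v.1 == Some true, c (pi v.1) == Some false & c v.2 == None]].
pose A : pred (T * T) :=
  [pred u : T * T | (u \in @upairs T) && (S u || S (u.2, u.1))].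
have upairP (a b : T) : upair a b = (a, b) \/ upair a b = (b, a).
  by rewrite /upair; case: ifP; [left|right].
have SA (a b : T) : upair a b \in A -> S (a, b) || S (b, a).
  rewrite inE => /andP[_]; case: (upairP a b) => -> //.
  by rewrite orbC.
exists A; split=> [u|| u uA].
- by rewrite inE => /andP[].
- apply: le_trans cP _; rewrite ler_nat -/S.
  pose nu (v : T * T) := upair v.1 v.2.
  (* The colours of the two ends differ and reveal the orientation of the pair. *)
  have nuI : {in S &, injective nu}.
    move=> [a b] [a' b'] /and4P[/= _ /eqP ca _ /eqP cb].
    move=> /and4P[/= _ /eqP ca' _ /eqP cb']; rewrite /nu /=.
    case: (upairP a b) => ->; case: (upairP a' b') => -> [] e1 e2; subst=> //.
      by rewrite ca in cb'.
    by rewrite ca in cb'.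
  rewrite -(card_in_image nuI); apply: subset_leq_card.
  apply/fintype.subsetP => _ /fintype.imageP[[a b] abS ->].
  have abS' : S (a, b) by [].
  have ab : a != b.
    apply/eqP => e; subst; move: abS => /and4P[/= _ /eqP -> _].
    by [].
  rewrite inE /nu /= /upair; case: ltngtP => /= [l|l|/val_inj/enum_rank_inj].
  + by rewrite inE /= l abS'.
  + by rewrite inE /= l abS' orbT.
  + by move/eqP; rewrite (negbTE ab).
- apply/negP => /SA vA; move: uA; rewrite inE => /andP[_].
  have no a b : S (a, b) -> ~~ (S (pi a, pi b) || S (pi b, pi a)).
    move=> /and4P[/= _ _ /eqP ca _]; apply/negP => /orP[] /and4P[/=] _.
      by rewrite ca.
    by move=> _ _; rewrite ca.
  case: u vA => a b /= vA /orP[/no|/no]; first by rewrite vA.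
  by rewrite orbC vA.
Qed.

(** The sum over all maps factors over points and is at most expR ([#|T|]^2 lam) <= 4/3. The
    identity accounts for 1, which leaves at most 1/3. *)
Lemma moved_union_bound (R : realType) (T : finType) (lam : R) :
  0 <= lam -> #|T|%:R ^+ 2 * lam <= 4^-1 ->
  \sum_(pi : {ffun T -> T} | (0 < #|moved pi|)%N) lam ^+ #|moved pi| < 1.
Proof.
move=> l0 lk.
have E (pi : {ffun T -> T}) : lam ^+ #|moved pi| =
    \prod_a (if pi a == a then 1 else lam).
  rewrite (eq_bigr (fun a => if pi a != a then lam else 1)) => [|a _].
    by rewrite -big_mkcond prodr_const.
  by case: eqP.
have S : \sum_(pi : {ffun T -> T}) lam ^+ #|moved pi| <= 4 / 3.
  under eq_bigr do rewrite E.
  rewrite -(bigA_distr_bigA (fun a c => if c == a then 1 else lam)) /=.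
  apply: (@le_trans _ _ (\prod_(a : T) expR (#|T|%:R * lam))).
    apply: ler_prod => a _; rewrite sumr_ge0 /= => [|c _]; last by case: ifP.
    rewrite (bigD1 a) //= eqxx (eq_bigr (fun=> lam)) => [|c /negbTE -> //].
    apply: le_trans (expR_ge1Dx _); rewrite lerD2l sumr_const -[leLHS]mulr_natl.
    by rewrite ler_wpM2r // ler_nat max_card.
  rewrite prodr_const -expRM_natl mulrA -expr2.
  apply: (@le_trans _ _ (expR 4^-1)); first by rewrite ler_expR.
  apply: le_trans (expR_le_inv _) _; first by lra.
  by rewrite le_eqVlt; apply/orP; left; apply/eqP; field.
pose id0 : {ffun T -> T} := [ffun a => a].
have m0 : #|moved id0| = 0%N.
  by apply: eq_card0 => a; rewrite !inE ffunE eqxx.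
move: S; rewrite (bigD1 id0) //= m0 expr0 => S.
apply: (@le_lt_trans _ _ 3^-1); last by lra.
apply: (@le_trans _ _ (\sum_(pi | pi != id0) lam ^+ #|moved pi|)); last by lra.
rewrite big_mkcond [leRHS]big_mkcond; apply: ler_sum => pi _.
case: ifP => [m|_]; last by case: ifP => // _; rewrite exprn_ge0.
by rewrite ifT //; apply: contraTneq m => ->; rewrite m0.
Qed.

(** Union bound over the maps that move a point. On the set given by [displaced_pairs], the
    transported matrix depends only on entries outside the set, so [disagreement_count] applies
    although both matrices are the same [q]. *)
Lemma rigid_exists (R : realType) : exists k0 (D : R), 0 < D /\
  forall T : finType, (k0 <= #|T|)%N -> exists q : {ffun T * T -> bool},
    forall pi : {ffun T -> T}, #|T|%:R * #|moved pi|%:R / D <= \sum_(v : T * T | v.1 != v.2)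
      (sym_fun q v.1 v.2 != sym_fun q (pi v.1) (pi v.2))%:R :> R.
Proof.
pose b := rate R; have b0 : 0 < b := rate_gt0 R.
(* For k >= 4, k - 2 >= k / 2, so [A pi] has at least moved * k / 54 pairs. Then 8/54 >= 1/7 gives
   the rate [b / 7], and disagreement on at least an eighth of the pairs gives 432 = 8 * 54. *)
have b7 : 0 < b / 7 by rewrite divr_gt0.
have [k1 k1P] := exp_small b7; exists (k1 + 4)%N, 432.
split=> [|T Tk]; first by rewrite ltr0n.
set k := #|T| in Tk *.
have k4 : 4 <= k%:R :> R by rewrite (ler_nat _ 4) (leq_trans _ Tk) // leq_addl.
have /choice[A AP] (pi : {ffun T -> T}) := displaced_pairs R pi.
have Am (pi : {ffun T -> T}) : #|moved pi|%:R * k%:R / 54 <= #|A pi|%:R :> R.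
  have [_ + _] := AP pi; apply: le_trans; rewrite -/k -!mulrA ler_wpM2l //; lra.
pose t (pi : {ffun T -> T}) := (#|A pi| %/ 8)%N.
pose y (pi : {ffun T -> T}) (q : {ffun T * T -> bool}) (u : T * T) :=
  sym_fun q (pi u.1) (pi u.2).
pose bad (pi : {ffun T -> T}) : pred {ffun T * T -> bool} :=
  [pred q : {ffun T * T -> bool} | (disagreement (A pi) q (y pi q) <= t pi)%N].
have badC (pi : {ffun T -> T}) : #|bad pi|%:R <=
    2 ^+ #|{: T * T}| * expR (- (b / 7 * k%:R)) ^+ #|moved pi| :> R.
  apply: (@le_trans _ _ (2 ^+ #|{: T * T}| * (3 / 4) ^+ #|A pi|)).
    apply: disagreement_count; last by rewrite mulnC leq_divM.
    have [_ _ Apart] := AP pi => q q' qq' u uA.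
    by rewrite /y /sym_fun qq' // Apart.
  rewrite ler_pM2l ?exprn_gt0 // rateE -/b -expRM_natl ler_expR.
  rewrite mulrN lerN2 [leRHS]mulrAC -mulrA.
  have /(ler_wpM2l (ltW b0)) H := Am pi.
  have P0 : 0 <= b * (#|moved pi|%:R * k%:R).
    by rewrite mulr_ge0 ?(ltW b0) // mulr_ge0.
  lra.
have [q qP] : exists q, forall pi : {ffun T -> T},
    (0 < #|moved pi|)%N -> ~~ bad pi q.
  apply: contrapT => /forallNP nq.
  have : #|{ffun T * T -> bool}|%:R <=
      \sum_(pi : {ffun T -> T} | (0 < #|moved pi|)%N) #|bad pi|%:R :> R.
    rewrite -natr_sum ler_nat big_mkcond.
    pose B (pi : {ffun T -> T}) : pred {ffun T * T -> bool} :=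
      [pred q | (0 < #|moved pi|)%N && bad pi q].
    apply: leq_trans (_ : \sum_pi #|B pi| <= _)%N.
      apply: card_exists_le => q _; apply: contrapT => /forallNP nB.
      apply: (nq q) => pi m0; apply/negP => bq; apply: (nB pi).
      by rewrite /B /= m0 bq.
    apply: leq_sum => pi _; case: ifP => m0; last first.
      by rewrite leqn0; apply/eqP/eq_card0 => q; rewrite !inE m0.
    by apply: subset_leq_card; apply/fintype.subsetP => q; rewrite !inE m0.
  apply/negP; rewrite -ltNge.
  apply: (@le_lt_trans _ _ (\sum_(pi : {ffun T -> T} | (0 < #|moved pi|)%N)
    2 ^+ #|{: T * T}| * expR (- (b / 7 * k%:R)) ^+ #|moved pi|)).
    by apply: ler_sum => pi _; exact: badC.
  rewrite -mulr_sumr card_ffun card_bool natrX -[ltRHS]mulr1.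
  rewrite ltr_pM2l ?exprn_gt0 //; apply: moved_union_bound; first exact: expR_ge0.
  by apply: k1P; apply: leq_trans Tk; rewrite leq_addr.
exists q => pi; have [m0|] := posnP #|moved pi|.
  by rewrite m0 mulr0 mul0r sumr_ge0.
move=> /qP; rewrite /bad /= -ltnNge => tq.
have [AU _ _] := AP pi.
apply: le_trans (disagreement_le_sum R q q pi AU).
apply: (@le_trans _ _ (t pi).+1%:R); last by rewrite ler_nat.
have : #|A pi|%:R <= 8 * (t pi).+1%:R :> R.
  by rewrite -natrM ler_nat mulnC ltnW // ltn_ceil.
by move: (Am pi); lra.
Qed.

(** * Unknown block sizes: the rate rho^2 sqrt(k / n) *)

Lemma one_plus_expR (R : realType) (x : R) n : 0 <= x ->
  (1 + x) ^+ n <= expR (n%:R * x).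
Proof.
move=> x0; rewrite expRM_natl lerXn2r ?nnegrE ?expR_ge0 ?addr_ge0 //.
exact: expR_ge1Dx.
Qed.

(** The blocks come in [K] pairs and [th i] tells which block of pair [i] is the larger one, so the
    total mass is 1 for every [th]. *)
Definition perturbed_mass (R : realType) K (s : R) (th : 'I_K -> bool)
    (t : 'I_K * bool) : R := (1 + s * (-1) ^+ (th t.1 (+) t.2)) / (2 * K%:R).

Lemma perturbed_mass_sum (R : realType) K (s : R) (th : 'I_K -> bool) (f : R -> R) :
  \sum_t f (perturbed_mass s th t) =
  K%:R * (f ((1 + s) / (2 * K%:R)) + f ((1 - s) / (2 * K%:R))).
Proof.
rewrite -(pair_bigA _ (fun i b => f (perturbed_mass s th (i, b)))) /=.
rewrite (eq_bigr (fun=> f ((1 + s) / (2 * K%:R)) + f ((1 - s) / (2 * K%:R)))).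
  by rewrite sumr_const card_ord [RHS]mulr_natl.
move=> i _; rewrite big_bool /perturbed_mass /=.
by case: (th i); rewrite /= expr0 expr1 mulr1 mulrN1 // addrC.
Qed.

(** The mass staying at [a] is at most [p2 a], so any excess of [p1 a] has to leave. *)
Lemma offdiag_mass (R : realType) (T : finType) (p1 p2 : T -> R) w a :
  coupling p1 p2 w ->
  0 <= \sum_c w a c * (c != a)%:R /\ p1 a - p2 a <= \sum_c w a c * (c != a)%:R.
Proof.
move=> [w0 w1 w2]; split; first by apply: sumr_ge0 => c _; rewrite mulr_ge0.
have -> : \sum_c w a c * (c != a)%:R = p1 a - w a a.
  rewrite -w1 (bigD1 a) // [in RHS](bigD1 a) //= eqxx mulr0 add0r.
  rewrite [RHS]addrC addKr; apply: eq_bigr => c ->.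
  by rewrite mulr1.
by rewrite lerD2l lerN2 -w2 (bigD1 a) //= lerDl sumr_ge0.
Qed.

(** By rigidity and [coupling_rounding], the loss controls the mass that the coupling moves off the
    diagonal, and this mass dominates the differences of block sizes. *)
Lemma perturbed_mass_separation (R : realType) K (s D : R)
    (th th0 : {ffun 'I_K -> bool}) (q : {ffun ('I_K * bool) * ('I_K * bool) -> bool})
    w :
  let Q (a b : 'I_K * bool) : R := (sym_fun q a b)%:R in
  (0 < K)%N -> 0 < D -> 0 <= s <= 2^-1 ->
  (forall pi : {ffun 'I_K * bool -> 'I_K * bool},
    (K * 2)%:R * #|moved pi|%:R / D <= \sum_(v : _ * _ | v.1 != v.2)
      (sym_fun q v.1 v.2 != sym_fun q (pi v.1) (pi v.2))%:R :> R) ->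
  coupling (perturbed_mass s th) (perturbed_mass s th0) w ->
  s * (disagreement predT th th0)%:R / (8 * D * K%:R) <= coupling_loss Q Q w.
Proof.
move=> Q K0 D0 /andP[s0 s1] qP cw.
have KR : 0 < K%:R :> R by rewrite ltr0n.
have mlo (u : {ffun 'I_K -> bool}) t : (4 * K%:R)^-1 <= perturbed_mass s u t.
  rewrite /perturbed_mass ler_pdivlMr ?mulr_gt0 //.
  rewrite [leLHS](_ : _ = 2^-1); last by field; rewrite gt_eqF.
  by case: (_ (+) _); rewrite ?expr0 ?expr1; lra.
have mup (u : {ffun 'I_K -> bool}) t : perturbed_mass s u t <= K%:R^-1.
  rewrite /perturbed_mass ler_pdivrMr ?mulr_gt0 //.
  rewrite [leRHS](_ : _ = 2); last by field; rewrite gt_eqF.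
  by case: (_ (+) _); rewrite ?expr0 ?expr1; lra.
have m0 : 0 < (4 * K%:R)^-1 :> R by rewrite invr_gt0 mulr_gt0.
have := @coupling_rounding R _ _ _ Q Q w
  (fun a c => (K * 2)%:R / D * (c != a)%:R) _ cw m0 (mlo th) _.
move=> H; apply: le_trans (H _) => [{H}|pi]; last first.
  rewrite -mulr_sumr -natr_sum.
  have -> : (\sum_a (pi a != a) = #|moved pi|)%N.
    rewrite -sum1_card [RHS]big_mkcond; apply: eq_bigr => a _.
    by rewrite inE; case: (_ != _).
  rewrite mulrAC; apply: le_trans (qP pi) _; apply: ler_sum => v _.
  rewrite /Q; case: (sym_fun q v.1 v.2); case: (sym_fun q (pi v.1) _);
    by rewrite /= ?subrr ?subr0 ?sub0r ?sqrrN ?expr1n ?expr0n.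
apply: (@le_trans _ _ ((4 * K%:R)^-1 ^+ 2 * \sum_a
    (K%:R * ((K * 2)%:R / D)) * \sum_c w a c * (c != a)%:R)); last first.
  rewrite ler_pM2l ?exprn_gt0 //; apply: ler_sum => a _.
  rewrite mulr_sumr; apply: ler_sum => c _.
  have [w0 _ _] := cw.
  have p0 := lt_le_trans m0 (mlo th a).
  rewrite (_ : w a c / _ * _ = (perturbed_mass s th a)^-1 *
    ((K * 2)%:R / D * (w a c * (c != a)%:R))); last by field; rewrite !gt_eqF.
  have g0 : 0 <= (K * 2)%:R / D * (w a c * (c != a)%:R).
    by apply: mulr_ge0; [rewrite divr_ge0 // ltW|exact: mulr_ge0].
  rewrite -mulrA ler_wpM2r //.
  by rewrite -[leLHS]invrK lef_pV2 ?posrE ?invr_gt0.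
have dis : s * (disagreement predT th th0)%:R / K%:R <=
    \sum_a \sum_c w a c * (c != a)%:R.
  rewrite (eq_bigr (fun a : 'I_K * bool =>
    \sum_c w (a.1, a.2) c * (c != (a.1, a.2))%:R)); last by case.
  rewrite -(pair_bigA _ (fun i b => \sum_c w (i, b) c * (c != (i, b))%:R)) /=.
  rewrite /disagreement -sum1_card natr_sum big_mkcond mulr_sumr mulr_suml.
  apply: ler_sum => i _; rewrite inE /=.
  have pos b := (offdiag_mass (i, b) cw).1.
  (* Of pair [i] only the block that is larger under [th] is kept; where the signs differ, its
     excess is exactly s / K. *)
  rewrite (bigD1 (th i)) //= -[leLHS]addr0 lerD ?sumr_ge0 //.
  case: ifP => ti; last by rewrite mulr0 mul0r.
  apply: le_trans (offdiag_mass (i, th i) cw).2.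
  rewrite /perturbed_mass /= addbb.
  have -> : th0 i (+) th i by move: ti; case: (th i); case: (th0 i).
  rewrite expr0 expr1 le_eqVlt; apply/orP; left; apply/eqP.
  by field; rewrite gt_eqF.
rewrite -mulr_sumr mulrA.
have -> : (4 * K%:R)^-1 ^+ 2 * (K%:R * ((K * 2)%:R / D)) = (8 * D)^-1.
  by rewrite natrM; field; rewrite !gt_eqF.
have D8 : 0 <= (8 * D)^-1 by rewrite invr_ge0 mulr_ge0 // ltW.
apply: le_trans (ler_wpM2l D8 dis).
by rewrite le_eqVlt; apply/orP; left; apply/eqP; field; rewrite !gt_eqF.
Qed.

Lemma minimax_sizes (R : realType) : exists k0 (C : R), 0 < C /\
  forall (rho : R) (k n : nat), 0 < rho <= 1 -> (k0 <= k <= n)%N -> (2 <= k)%N ->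
  ((C * (rho ^+ 2 * Num.sqrt ((k%:R - 1) / n%:R)))%:E
    <= minimax_risk n k rho)%E.
Proof.
pose b := 4 * rate R; have b0 : 0 < b by rewrite mulr_gt0 // rate_gt0.
have [k1 k1P] := exp_small b0.
have [k2 [D1 [D10 rigid]]] := rigid_exists R.
(* The bound by [b] gives n s^2 <= b K, hence a second moment at most expR (b K); the bound by 1/2,
   with K / n <= 1/2, gives s <= 1/2. *)
pose gam := Num.min b 2^-1.
have gam0 : 0 < gam by rewrite /gam lt_min b0 invr_gt0 ltr0n.
have gamb : gam <= b by rewrite /gam ge_min lexx.
have gam1 : gam <= 2^-1 by rewrite /gam ge_min lexx orbT.
pose D := 8 * D1; have D0 : 0 < D by rewrite mulr_gt0.
exists (2 * (k1 + k2).+1)%N, (Num.sqrt (gam / 2) / (64 * D)); split.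
  by rewrite divr_gt0 ?mulr_gt0 // sqrtr_gt0 divr_gt0.
move=> rho k n rho01 /andP[kk0 kn] kge2; have /andP[rho0 rho1] := rho01.
(* The blocks are grouped in pairs; for odd [k] one block stays empty. *)
pose K := k./2.
have Kk : (K * 2 <= k)%N by rewrite muln2 -[leqRHS]odd_double_half leq_addl.
have kK : (k <= (K * 2).+1)%N.
  by rewrite muln2 -[leqLHS]odd_double_half -add1n leq_add2r leq_b1.
have K12 : (k1 + k2 < K)%N by rewrite /K geq_half_double -mul2n.
have K0 : (0 < K)%N by apply: leq_ltn_trans K12.
have KR : 0 < K%:R :> R by rewrite ltr0n.
have nR : 0 < n%:R :> R by rewrite ltr0n (leq_trans _ kn) // (leq_trans _ kge2).
have Kn : K%:R / n%:R <= 2^-1 :> R.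
  rewrite ler_pdivrMr // ler_pdivlMl // -natrM ler_nat.
  by apply: leq_trans kn; rewrite mulnC.
pose T : finType := ('I_K * bool)%type.
have cT : #|T| = (K * 2)%N by rewrite card_prod card_ord card_bool.
have [|q qP] := rigid T.
  rewrite cT (leq_trans _ (leq_pmulr K (isT : 0 < 2)%N)) //.
  by apply: leq_trans (ltnW K12); rewrite leq_addl.
pose Th : finType := {ffun 'I_K -> bool}.
pose s := Num.sqrt (gam * (K%:R / n%:R)).
have gKn : 0 < gam * (K%:R / n%:R) by rewrite mulr_gt0 // divr_gt0.
have s0 : 0 <= s by exact: sqrtr_ge0.
have sE : s ^+ 2 = gam * (K%:R / n%:R) by rewrite sqr_sqrtr // ltW.
have s1 : s <= 2^-1.
  have s2 : s ^+ 2 <= 2^-1 ^+ 2 by rewrite sE; nra.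
  by rewrite -(ler_pXn2r (ltn0Sn 1)) ?nnegrE ?invr_ge0.
pose p (th : Th) := perturbed_mass s th.
pose pref (_ : T) : R := (2 * K%:R)^-1.
pose Q (_ : Th) (u v : T) : R := (sym_fun q u v)%:R.
have p0 th t : 0 <= p th t.
  rewrite /p /perturbed_mass divr_ge0 ?mulr_ge0 //.
  by case: (_ (+) _); rewrite ?expr0 ?expr1; lra.
have p1 th : \sum_t p th t = 1.
  by rewrite (perturbed_mass_sum s th id); field; rewrite gt_eqF.
have pref0 t : 0 < pref t by rewrite invr_gt0 mulr_gt0.
have pref1 : \sum_t pref t = 1.
  by rewrite sumr_const cT -[LHS]mulr_natl natrM /pref; field; rewrite gt_eqF.
have Q01 th u v : 0 <= Q th u v <= 1.
  by rewrite /Q; case: (sym_fun _ _ _); rewrite /= ?lexx ?ler01.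
have rQ01 th u v : 0 <= rho * Q th u v <= 1.
  by rewrite /Q; case: (sym_fun _ _ _); rewrite /= ?mulr1 ?mulr0
    ?lexx ?ler01 ?rho1 ?(ltW rho0).
have Qsym th u v : Q th u v = Q th v u by rewrite /Q sym_funC.
pose B := expR (b * K%:R).
have B0 : 0 < B by exact: expR_gt0.
have /choice[g gP] th := @sbm_pmf_le_labels R T n pref (p th)
  (fun u v => rho * Q th u v) B B0 pref0 (p0 th) (rQ01 th).
have gG th : \sum_a g th a <= 4^-1.
  have [_ -> _] := gP th.
  rewrite ler_pdivrMr ?mulr_gt0 // mulrA mulVf // mul1r.
  rewrite (perturbed_mass_sum s th (fun x => x ^+ 2 / (2 * K%:R)^-1)).
  rewrite (_ : K%:R * _ = 1 + s ^+ 2); last by field; rewrite gt_eqF.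
  apply: le_trans (one_plus_expR _ (sqr_ge0 _)) _.
  rewrite ler_expR sE mulrCA [n%:R * _]mulrC divfK ?gt_eqF //.
  by rewrite ler_pM2r.
pose t := (K %/ 8)%N.
have Kt : K%:R <= 8 * t.+1%:R :> R.
  by rewrite -natrM ler_nat mulnC ltnW // ltn_ceil.
(* Here [4 * r / rho ^+ 2] is the separation for more than [t] differing signs. The maps are already
   handled by rigidity, so a single Hamming ball remains. *)
pose r := rho ^+ 2 * (s * t.+1%:R / (D * K%:R)) / 4.
have r0 : 0 <= r.
  by rewrite /r divr_ge0 // mulr_ge0 ?sqr_ge0 // divr_ge0 ?mulr_ge0 // ltW.
pose L := 2 ^+ #|'I_K| * (3 / 4) ^+ #|'I_K| : R.
have closeL th0 : #|[pred th | `[< sbm_close (p th) (p th0)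
    (Q th) (Q th0) (4 * r / rho ^+ 2) >]]|%:R <= L.
  pose ball : pred Th := [pred th : Th | (disagreement predT th th0 <= t)%N].
  apply: (@le_trans _ _ #|ball|%:R).
    rewrite ler_nat; apply: subset_leq_card; apply/fintype.subsetP => th.
    rewrite inE => -[w [cw]]; apply: contraTT.
    rewrite inE -ltnNge -leNgt => td.
    apply: le_trans (perturbed_mass_separation K0 D10 _ _ cw); last 2 first.
    - by rewrite s0.
    - by move=> pi; rewrite -cT; exact: qP.
    have -> : 4 * r / rho ^+ 2 = s * t.+1%:R / (D * K%:R).
      by rewrite /r; field; rewrite !gt_eqF.
    rewrite ler_pM2r ?invr_gt0 ?mulr_gt0 // ler_wpM2l // ler_nat.
    exact: td.
  have := @disagreement_count R 'I_K predT (fun=> th0) t.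
  have -> : #|@predT 'I_K| = #|'I_K| by apply: eq_card.
  apply => //.
  by rewrite card_ord mulnC leq_divM.
have := @minimax_list_bound R Th T p Q rho r B 4^-1 L k n
  (sbm_pmf pref (fun u v => rho * (sym_fun q u v)%:R)) g.
have Th0 : (0 < #|Th|)%N by apply/card_gt0P; exists [ffun=> false].
rewrite cT => /(_ Th0 Kk rho01 r0 (ltW B0) p0 p1 Qsym Q01
  (fun a => sbm_pmf_ge0 _ (fun t => ltW (pref0 t)) (rQ01 [ffun=> false]))
  (sbm_pmf_sum1 _ _ pref1)
  (fun th => let: And3 h _ _ := gP th in h) gG
  (fun th => let: And3 _ _ h := gP th in h) closeL).
apply: le_trans; rewrite lee_fin.
(* With [b = 4 * rate R], (3/4)^K is exp(-2bK); half of this exponent cancels [B]. *)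
have LB : B * L / #|Th|%:R <= 4^-1.
  have -> : B * L / #|Th|%:R = B * (3 / 4) ^+ K.
    rewrite /L !card_ffun card_bool !card_ord !natrX.
    by field; rewrite expf_neq0.
  have kK1 : (k1 <= K)%N by apply: leq_trans (ltnW K12); rewrite leq_addr.
  apply: le_trans (k1P K kK1); rewrite rateE -expRD.
  rewrite -[leLHS]mul1r ler_pM ?expR_ge0 //.
    by rewrite -natrX ler1n expn_gt0 K0.
  by rewrite ler_expR /b; lra.
apply: (@le_trans _ _ (r * 2^-1)); last by rewrite ler_wpM2l //; lra.
have sk : Num.sqrt (gam / 2) * Num.sqrt ((k%:R - 1) / n%:R) <= s.
  rewrite -sqrtrM ?divr_ge0 ?(ltW gam0) // ler_wsqrtr //.
  rewrite -[leLHS]mulrA ler_pM2l // mulrA ler_pM2r ?invr_gt0 //.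
  have : k%:R <= K%:R * 2 + 1 :> R by rewrite -natrM natr1 ler_nat.
  by lra.
have st : s / (8 * D) <= s * t.+1%:R / (D * K%:R).
  rewrite -[leRHS]mulrA ler_wpM2l // -[leLHS]div1r ler_pdivlMr ?mulr_gt0 //.
  rewrite (_ : 1 / _ * _ = K%:R / 8); last by field; rewrite gt_eqF.
  by lra.
apply: (@le_trans _ _ (rho ^+ 2 * (s / (8 * D)) / 8)).
  have -> : rho ^+ 2 * (s / (8 * D)) / 8 = rho ^+ 2 * s / (64 * D).
    by field; rewrite gt_eqF.
  have -> : Num.sqrt (gam / 2) / (64 * D) *
      (rho ^+ 2 * Num.sqrt ((k%:R - 1) / n%:R)) =
      rho ^+ 2 * (Num.sqrt (gam / 2) * Num.sqrt ((k%:R - 1) / n%:R)) / (64 * D).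
    by ring.
  by rewrite ler_pM2r ?invr_gt0 ?mulr_gt0 // ler_pM2l ?exprn_gt0.
have -> : r * 2^-1 = rho ^+ 2 * (s * t.+1%:R / (D * K%:R)) / 8.
  by rewrite /r -mulrA; congr (_ * _); field.
by rewrite ler_pM2r ?invr_gt0 // ler_pM2l ?exprn_gt0.
Qed.

(** * Two blocks of unequal sizes, for small k *)

(** For 0/1 entries (x - y)^2 >= x - y, so the loss dominates the difference of the overall edge
    densities, which depend only on the marginals. *)
Lemma coupling_loss_ge_diff (R : realType) (T : finType) (p1 p2 : T -> R)
    (q1 q2 : T -> T -> bool) (w : T -> T -> R) :
  coupling p1 p2 w ->
  \sum_a \sum_b p1 a * p1 b * (q1 a b)%:R - \sum_a \sum_b p2 a * p2 b * (q2 a b)%:R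
  <= coupling_loss (fun a b => (q1 a b)%:R) (fun a b => (q2 a b)%:R) w.
Proof.
move=> [w0 w1 w2].
have E1 : \sum_a \sum_b p1 a * p1 b * (q1 a b)%:R =
    \sum_(u : T * T) \sum_(v : T * T) w u.1 u.2 * w v.1 v.2 * (q1 u.1 v.1)%:R.
  rewrite -(pair_bigA _ (fun a c => \sum_(v : T * T)
    w a c * w v.1 v.2 * (q1 a v.1)%:R)) /=; apply: eq_bigr => a _.
  rewrite exchange_big -(pair_bigA _ (fun b d =>
    \sum_c w a c * w b d * (q1 a b)%:R)) /=; apply: eq_bigr => b _.
  rewrite -w1 -w1 mulr_sumr mulr_suml; apply: eq_bigr => d _.
  by rewrite mulr_suml mulr_suml.
have E2 : \sum_a \sum_b p2 a * p2 b * (q2 a b)%:R =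
    \sum_(u : T * T) \sum_(v : T * T) w u.1 u.2 * w v.1 v.2 * (q2 u.2 v.2)%:R.
  rewrite -(pair_bigA _ (fun a c => \sum_(v : T * T)
    w a c * w v.1 v.2 * (q2 c v.2)%:R)) /= [RHS]exchange_big; apply: eq_bigr => c _.
  rewrite [RHS]exchange_big -(pair_bigA _ (fun b d =>
    \sum_a w a c * w b d * (q2 c d)%:R)) /= [RHS]exchange_big; apply: eq_bigr => d _.
  rewrite -w2 -w2 mulr_sumr mulr_suml; apply: eq_bigr => b _.
  by rewrite mulr_suml mulr_suml.
rewrite E1 E2 -sumrB; apply: ler_sum => u _; rewrite -sumrB.
apply: ler_sum => v _; rewrite -mulrBr ler_wpM2l ?mulr_ge0 //.
by case: (q1 _ _); case: (q2 _ _); rewrite /= ?subrr ?subr0 ?sub0r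
  ?sqrrN ?expr1n ?expr0n //; lra.
Qed.

Lemma coupling_loss_sym (R : realType) (T : finType) (p1 p2 : T -> R)
    (Q1 Q2 : T -> T -> R) (w : T -> T -> R) : coupling p1 p2 w ->
  coupling p2 p1 (fun a b => w b a) /\
  coupling_loss Q2 Q1 (fun a b => w b a) = coupling_loss Q1 Q2 w.
Proof.
move=> [w0 w1 w2]; split=> //; rewrite /coupling_loss.
pose h (u : T * T) := (u.2, u.1).
have hI : injective h by move=> [? ?] [? ?] [-> ->].
rewrite (reindex_inj hI); apply: eq_bigr => u _.
rewrite (reindex_inj hI); apply: eq_bigr => v _ /=.
by rewrite -sqrrN opprB.
Qed.

(** A single clique block, of mass (1 + s) / 2 or 1/2: the edge densities differ by at least s /
    2. *)
Lemma minimax_two_sizes (R : realType) (rho : R) (k n : nat) :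
  0 < rho <= 1 -> (2 <= k <= n)%N ->
  ((160^-1 * (rho ^+ 2 * Num.sqrt (n%:R^-1)))%:E <= minimax_risk n k rho)%E.
Proof.
move=> rho01 /andP[k2 kn]; have /andP[rho0 rho1] := rho01.
have n0 : 0 < n%:R :> R by rewrite ltr0n (leq_trans _ kn) // (leq_trans _ k2).
have n1 : 1 <= n%:R :> R by rewrite ler1n -(ltr0n R).
(* Chosen so that n s^2 = 1/16; the second moment is then at most 16/15 <= 8/7, and the constants
   3/4 and 8/21 are those of the two-block signal. *)
pose s := Num.sqrt (n%:R^-1 : R) / 4.
have sE : s ^+ 2 = (16 * n%:R)^-1.
  rewrite /s exprMn sqr_sqrtr ?invr_ge0 //.
  by field; rewrite gt_eqF.
have s0 : 0 < s by rewrite divr_gt0 // sqrtr_gt0 invr_gt0.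
have s1 : s <= 1.
  rewrite /s ler_pdivrMr // mul1r; apply: (@le_trans _ _ 1); last by lra.
  rewrite -[leRHS]sqrtr1 ler_wsqrtr //. by rewrite invf_le1.
pose p (th t : bool) : R := if th then (1 + s * (-1) ^+ t) / 2 else 2^-1.
pose pref (_ : bool) : R := 2^-1.
pose q (_ a b : bool) := ~~ a && ~~ b.
pose Q th a b : R := (q th a b)%:R.
have p0 th t : 0 <= p th t.
  rewrite /p; case: th; last by rewrite invr_ge0.
  by case: t; rewrite ?expr0 ?expr1 divr_ge0 //; lra.
have p1 th : \sum_t p th t = 1.
  by rewrite big_bool /p; case: th; rewrite ?expr0 ?expr1 /=; field.
have pref0 t : 0 < pref t by rewrite invr_gt0.
have pref1 : \sum_t pref t = 1 by rewrite big_bool /pref /=; field.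
have Q01 th a b : 0 <= Q th a b <= 1.
  by rewrite /Q; case: (q _ _ _); rewrite /= ?lexx ?ler01.
have rQ01 th a b : 0 <= rho * Q th a b <= 1.
  by rewrite /Q; case: (q _ _ _); rewrite /= ?mulr1 ?mulr0
    ?lexx ?ler01 ?rho1 ?(ltW rho0).
have Qsym th a b : Q th a b = Q th b a by rewrite /Q /q andbC.
have c34 : 0 < 3 / 4 :> R by rewrite divr_gt0.
have /choice[g gP] th := @sbm_pmf_le_labels R bool n pref (p th)
  (fun u v => rho * Q th u v) (3 / 4) c34 pref0 (p0 th) (rQ01 th).
have gG th : \sum_a g th a <= 8 / 21.
  have [_ -> _] := gP th.
  rewrite (_ : 8 / 21 = 8 / 7 / (4 * (3 / 4))); last by field.
  rewrite ler_pM2r ?invr_gt0 ?mulr_gt0 //.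
  have -> : \sum_t p th t ^+ 2 / pref t = 1 + (if th then s ^+ 2 else 0).
    rewrite big_bool /p /pref; case: th; rewrite /= ?expr0 ?expr1; last by field.
    have two (y : R) : 2 != 0 :> R -> ((1 + y * -1) / 2) ^+ 2 / 2^-1 +
        ((1 + y * 1) / 2) ^+ 2 / 2^-1 = 1 + y ^+ 2 by move=> ?; field.
    by apply: two; rewrite pnatr_eq0.
  case: th; last by rewrite addr0 expr1n; lra.
  apply: le_trans (one_plus_expR _ (sqr_ge0 _)) _.
  have -> : n%:R * s ^+ 2 = 16^-1 by rewrite sE; field; rewrite gt_eqF.
  apply: le_trans (expR_le_inv _) _; first by lra.
  by rewrite (_ : (1 - 16^-1)^-1 = 16 / 15); [lra|field].
pose r := rho ^+ 2 * s / 8.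
have r0 : 0 <= r by rewrite /r divr_ge0 // mulr_ge0 ?sqr_ge0 // ltW.
have rE : 4 * r / rho ^+ 2 = s / 2 by rewrite /r; field; rewrite gt_eqF.
have sep w : coupling (p true) (p false) w ->
    s / 2 <= coupling_loss (Q true) (Q false) w.
  move=> cw; apply: le_trans (coupling_loss_ge_diff (q true) (q false) cw).
  rewrite !big_bool /q /p /= !mulr0 !mulr1 !add0r ?expr0.
  by have := sqr_ge0 s; lra.
have closeL th0 : (#|[pred th | `[< sbm_close (p th) (p th0)
    (Q th) (Q th0) (4 * r / rho ^+ 2) >]]|%:R <= (1 : R)).
  rewrite lern1; apply: (@leq_trans #|pred1 th0|); last by rewrite card1.
  apply: subset_leq_card; apply/fintype.subsetP => th.
  rewrite rE !inE => -[w [cw]]; apply: contraTT; rewrite -leNgt.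
  case: th cw; case: th0 => //= cw _; first exact: sep.
  by have [cw' <-] := coupling_loss_sym (Q false) (Q true) cw; exact: sep.
have := @minimax_list_bound R bool bool p Q rho r (3 / 4) (8 / 21) 1 k n
  (sbm_pmf pref (fun a b => rho * Q true a b)) g.
rewrite card_bool => /(_ isT k2 rho01 r0 (ltW c34) p0 p1 Qsym Q01
  (fun a => sbm_pmf_ge0 _ (fun t => ltW (pref0 t)) (rQ01 true))
  (sbm_pmf_sum1 _ _ pref1)
  (fun th => let: And3 h _ _ := gP th in h) gG
  (fun th => let: And3 _ _ h := gP th in h) closeL).
apply: le_trans; rewrite lee_fin.
apply: (@le_trans _ _ (r * 5^-1)); last by rewrite ler_wpM2l //; lra.
by rewrite /r /s; lra.
Qed.

(** * Assembling the three rates *)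

Lemma ge_third_sum (R : realType) (c a b d : R) (M : \bar R) :
  ((c * a)%:E <= M)%E -> ((c * b)%:E <= M)%E -> ((c * d)%:E <= M)%E ->
  ((c / 3 * (a + b + d))%:E <= M)%E.
Proof.
case: M => [m||]; rewrite ?leey // !lee_fin => am bm dm.
rewrite (_ : _ * _ = (c * a + c * b + c * d) / 3); last by field.
by rewrite ler_pdivrMr //; lra.
Qed.

(** Only [x] and [y] are truncated on the right, matching the available bounds: the block-size rate
    is proved without a minimum. *)
Lemma min_sum3_le (R : realType) (x y z v : R) :
  0 <= x -> 0 <= y -> 0 <= z -> 0 <= v ->
  Num.min (x + y + z) v <= Num.min x v + Num.min y v + z.
Proof.
move=> x0 y0 z0 v0.
have [xv|xv] := leP x v; have [yv|yv] := leP y v; rewrite ge_min; apply/orP.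
- by left.
- by right; lra.
- by right; lra.
- by right; lra.
Qed.

Theorem proposition3p4 (R : realType) :
  exists C : R, 0 < C /\
    forall (rho : R) (k n : nat), 0 < rho <= 1 -> (2 <= k <= n)%N ->
      ((C * Num.min
              (rho * ((k%:R ^+ 2) / (n%:R ^+ 2) + n%:R^-1)
               + rho ^+ 2 * Num.sqrt ((k%:R - 1) / n%:R))
              (rho ^+ 2))%:E <= minimax_risk n k rho)%E.
Proof.
have [k1 [C1 [C10 minimaxM]]] := minimax_matrix R.
have [k2 [C2 [C20 minimaxS]]] := minimax_sizes R.
pose k0 := (k1 + k2).+1.
have k0R : 1 <= k0%:R :> R by rewrite ler1n.
pose c0 : R := Num.min 640^-1 (Num.min C1 C2).
have c00 : 0 < c0 by rewrite /c0 !lt_min C10 C20 invr_gt0 ltr0n.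
(* The division by k0^2 serves k < k0, where k^2 / n^2 <= k0^2 / n and sqrt((k - 1) / n) <= k0^2
   sqrt(1 / n) reduce two of the rates to the two-block bounds. *)
pose c := c0 / k0%:R ^+ 2.
have k02 : 1 <= k0%:R ^+ 2 :> R by rewrite exprn_ege1.
have c_gt0 : 0 < c by rewrite divr_gt0 // (lt_le_trans ltr01).
have cc0 : c <= c0 by rewrite ler_pdivrMr ?(lt_le_trans ltr01) // ler_peMr // ltW.
have [cm cC1 cC2] : [/\ c0 <= 640^-1, c0 <= C1 & c0 <= C2].
  by rewrite /c0 !ge_min !lexx !orbT.
exists (c / 3); split; first by rewrite divr_gt0.
move=> rho k n rho01 kn; have /andP[rho0 rho1] := rho01.
have /andP[kge2 kn'] := kn.
have nR : 1 <= n%:R :> R by rewrite ler1n (leq_trans _ kn') // (leq_trans _ kge2).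
have n0 : 0 < n%:R :> R by lra.
have kR : 1 <= k%:R :> R by rewrite ler1n (leq_trans _ kge2).
set M := minimax_risk n k rho.
set S := Num.sqrt ((k%:R - 1) / n%:R).
set r2 := rho ^+ 2; have r20 : 0 < r2 by rewrite exprn_gt0.
rewrite mulrDr.
set X := rho * (_ / _); set Y := rho / n%:R.
have X0 : 0 <= X by rewrite mulr_ge0 ?(ltW rho0) // divr_ge0 ?sqr_ge0.
have Y0 : 0 <= Y by rewrite divr_ge0 // ltW.
have Z0 : 0 <= r2 * S by rewrite mulr_ge0 ?sqrtr_ge0 // ltW.
have scale (c1 v v' : R) : 0 <= v -> v <= v' -> c <= c1 ->
    ((c1 * v')%:E <= M)%E -> ((c * v)%:E <= M)%E.
  move=> v0 vv' c1c; apply: le_trans; rewrite lee_fin.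
  by rewrite ler_pM // ltW.
have minY0 : 0 <= Num.min Y r2 by rewrite le_min Y0 ltW.
have minX0 : 0 <= Num.min X r2 by rewrite le_min X0 ltW.
have FY : ((c * Num.min Y r2)%:E <= M)%E.
  apply: (scale 640^-1 _ _ minY0 (lexx _) _ (minimax_two_block_signal rho01 kn)).
  exact: le_trans cm.
have [FX FZ] : ((c * Num.min X r2)%:E <= M)%E /\ ((c * (r2 * S))%:E <= M)%E.
  have [kk0|kk0] := leqP k0 k.
    have kk : (k1 + k2 <= k)%N by apply: ltnW.
    split.
      apply: (scale C1 _ _ minX0 (lexx _) _ (minimaxM rho k n rho01 _ kge2)).
        exact: le_trans cC1.
      by rewrite kn' andbT (leq_trans _ kk) // leq_addr.
    apply: (scale C2 _ _ Z0 (lexx _) _ (minimaxS rho k n rho01 _ kge2)).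
      exact: le_trans cC2.
    by rewrite kn' andbT (leq_trans _ kk) // leq_addl.
  have kk : k%:R <= k0%:R :> R by rewrite ler_nat ltnW.
  have k2k : k%:R ^+ 2 <= k0%:R ^+ 2 :> R by rewrite lerXn2r ?nnegrE.
  split.
    apply: le_trans (minimax_two_block_signal rho01 kn); rewrite lee_fin.
    apply: (@le_trans _ _ (c0 * Num.min Y r2)); last by rewrite ler_wpM2r.
    rewrite /c -mulrA ler_pM2l // ler_pdivrMl ?(lt_le_trans ltr01) //.
    have XY : X <= k0%:R ^+ 2 * Y.
      rewrite /X /Y [leRHS]mulrCA ler_pM2l // ler_pdivrMr ?exprn_gt0 //.
      apply: (le_trans k2k).
      rewrite -mulrA ler_peMr ?sqr_ge0 // mulrC expr2 mulfK ?gt_eqF //.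
    rewrite minr_pMr ?(le_trans ler01) // le_min !ge_min XY /=.
    by rewrite ler_peMl ?orbT // ltW.
  apply: le_trans (minimax_two_sizes rho01 kn); rewrite lee_fin.
  apply: (@le_trans _ _ (c0 * (r2 * Num.sqrt n%:R^-1))); last first.
    rewrite (ler_wpM2r (mulr_ge0 (ltW r20) (sqrtr_ge0 _))) //.
    by apply: le_trans cm _; lra.
  rewrite /c -mulrA ler_pM2l // mulrCA ler_pM2l //.
  rewrite ler_pdivrMl ?(lt_le_trans ltr01) //.
  rewrite -[k0%:R ^+ 2]ger0_norm ?sqr_ge0 // -sqrtr_sqr -sqrtrM ?sqr_ge0 //.
  rewrite ler_wsqrtr // ler_pM2r ?invr_gt0 //.
  apply: (@le_trans _ _ (k0%:R ^+ 2)); first by nra.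
  by rewrite [leRHS]expr2 ler_peMl ?sqr_ge0.
apply: le_trans (ge_third_sum FX FY FZ); rewrite lee_fin.
have c30 : 0 < c / 3 by rewrite (divr_gt0 c_gt0).
by rewrite (ler_pM2l c30) min_sum3_le // ltW.
Qed.
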